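(* Let $\lambda>1$, $\lambda_j=\lambda^j$, $\nu,\mu>0$, $d_i>0$, $\theta=\frac{5-\delta}{2}$, and consider the system, for $j\ge1$ and with $a_0=b_0=0$, $$\frac{d}{dt}a_j=-\nu\lambda_j^2a_j-\lambda_j^\theta a_ja_{j+1}+\lambda_{j-1}^\theta a_{j-1}^2+\lambda_j^\theta b_jb_{j+1}-\lambda_{j-1}^\theta b_{j-1}^2,$$ $$\frac{d}{dt}b_j=-\mu\lambda_j^2b_j-\lambda_j^\theta a_jb_{j+1}+\lambda_j^\theta b_ja_{j+1}-d_i\left(\lambda_j^{\theta+1}b_jb_{j+1}-\lambda_{j-1}^{\theta+1}b_{j-1}^2\right).$$ If $\delta\in(1,3]$, then for any initial data $(a^0,b^0)\in H^1\times H^1$ there exist $T>0$ and a strong solution $(a(t),b(t))$ of the system on $[0,T]$ with $(a(0),b(0))=(a^0,b^0)$. If $\delta=3$, the strong solution is global, i.e. it is a strong solution on $[0,\infty)$.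
   Context: Sequences are real and indexed by $j\ge1$, $a(t)=(a_j(t))_{j\ge1}$, $b(t)=(b_j(t))_{j\ge1}$; the convention $a_0=b_0=0$ is used in the equations for $j=1$. $H=\ell^2$. For $s\in\mathbb R$, $\|u\|_s=(\sum_{n\ge1}\lambda_n^{2s}u_n^2)^{1/2}$ and $H^s$ is the space of sequences with $\|u\|_s<\infty$. A solution on an interval is a pair of $H$-valued functions $(a(t),b(t))$ whose components $a_j,b_j$ are $C^1$ on that interval and satisfy the system for all $j$. A solution is strong on $[T_1,T_2]$ if $\|a\|_1$ and $\|b\|_1$ are bounded on $[T_1,T_2]$; it is strong on $[T_1,\infty)$ if it is strong on $[T_1,T_2]$ for every $T_2>T_1$. *)

(* Defs.v *)
From Stdlib Require Import Reals.
From Coquelicot Require Import Coquelicot.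
Open Scope R_scope.

(** A real sequence [(u_j)_{j >= 1}] is represented by [u : nat -> R], the value
    [u 0%nat] being irrelevant: sums over [n >= 1] are shifted ([n = S k]), and
    the equations only read sequences through [zero_ext], which implements the
    convention [u_0 = 0]. *)

Definition zero_ext (u : nat -> R) (j : nat) : R :=
  match j with O => 0 | S _ => u j end.

Definition in_l2 (u : nat -> R) : Prop := ex_series (fun k => u (S k) ^ 2).

Definition Hs_term (lam s : R) (u : nat -> R) (n : nat) : R :=
  Rpower (lam ^ n) (2 * s) * u n ^ 2.

Definition in_Hs (lam s : R) (u : nat -> R) : Prop :=
  ex_series (fun k => Hs_term lam s u (S k)).

(** Meaningful only when [in_Hs lam s u] holds. *)
Definition Hs_norm (lam s : R) (u : nat -> R) : R :=
  sqrt (Series (fun k => Hs_term lam s u (S k))).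

(** The right-hand sides of the system, for [j >= 1]. *)
Definition rhs_a (lam theta nu : R) (a b : nat -> R) (j : nat) : R :=
  let L := fun k : nat => lam ^ k in
  let a := zero_ext a in
  let b := zero_ext b in
  - nu * L j ^ 2 * a j
  - Rpower (L j) theta * a j * a (S j)
  + Rpower (L (pred j)) theta * a (pred j) ^ 2
  + Rpower (L j) theta * b j * b (S j)
  - Rpower (L (pred j)) theta * b (pred j) ^ 2.

Definition rhs_b (lam theta mu d_i : R) (a b : nat -> R) (j : nat) : R :=
  let L := fun k : nat => lam ^ k in
  let a := zero_ext a in
  let b := zero_ext b in
  - mu * L j ^ 2 * b j
  - Rpower (L j) theta * a j * b (S j)
  + Rpower (L j) theta * b j * a (S j)
  - d_i * (Rpower (L j) (theta + 1) * b j * b (S j)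
           - Rpower (L (pred j)) (theta + 1) * b (pred j) ^ 2).

(** Derivatives and limits are relative to [D], hence one-sided at those
    endpoints of the interval [D] that belong to it. *)
Definition C1_on (D : R -> Prop) (f : R -> R) : Prop :=
  exists f' : R -> R,
    (forall t, D t -> D_in f f' D t) /\ (forall t, D t -> continue_in f' D t).

Definition solution_on (lam theta nu mu d_i : R) (D : R -> Prop)
    (a b : R -> nat -> R) : Prop :=
  (forall t, D t -> in_l2 (a t) /\ in_l2 (b t)) /\
  (forall j : nat, (1 <= j)%nat ->
     C1_on D (fun t => a t j) /\
     C1_on D (fun t => b t j) /\
     (forall t, D t ->
        D_in (fun t => a t j) (fun t => rhs_a lam theta nu (a t) (b t) j) D t /\
        D_in (fun t => b t j) (fun t => rhs_b lam theta mu d_i (a t) (b t) j) D t)).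

Definition Hs_bounded_on (lam s : R) (D : R -> Prop) (u : R -> nat -> R) : Prop :=
  exists M : R, forall t, D t -> in_Hs lam s (u t) /\ Hs_norm lam s (u t) <= M.

Definition Icc (T1 T2 : R) : R -> Prop := fun t => T1 <= t <= T2.
Definition Ici (T1 : R) : R -> Prop := fun t => T1 <= t.

Definition strong_solution_Icc (lam theta nu mu d_i T1 T2 : R)
    (a b : R -> nat -> R) : Prop :=
  solution_on lam theta nu mu d_i (Icc T1 T2) a b /\
  Hs_bounded_on lam 1 (Icc T1 T2) a /\
  Hs_bounded_on lam 1 (Icc T1 T2) b.

Definition strong_solution_Ici (lam theta nu mu d_i T1 : R)
    (a b : R -> nat -> R) : Prop :=
  solution_on lam theta nu mu d_i (Ici T1) a b /\
  forall T2, T1 < T2 -> strong_solution_Icc lam theta nu mu d_i T1 T2 a b.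

(* Main.v *)
(* Replace every component in the quadratic terms by its truncation at level
   M lambda^-j.  In the norm sup_j lambda^j |u_j| the truncated nonlinearity is
   Lipschitz with a loss of order lambda_j^theta, and theta < 2 is beaten by the
   dissipation lambda_j^2; hence Picard iteration on Duhamel's formula, in the
   norm weighted by exp (- kappa t) with kappa large, gives a solution for all
   times.  Duhamel also shows that lambda_j |u_j(t)| exceeds its initial value by
   at most O(lambda_j^(theta - 2)), which puts the solution in H^1 uniformly in
   time, and that sup_j lambda^j |u_j| increases by at most 1 during some fixed
   time eta, so the truncation is inactive on [0, eta].
   When delta = 3, i.e. theta = 1, let E_N and Y_N be the partial sums of
   |a|^2 + |b|^2 and of lambda_j^2 (a_j^2 + b_j^2).  While the truncation is
   inactive, E_N' <= - m Y_N and Y_N' <= C Y_N (Y_N + eps_N) with eps_N -> 0, so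
   Y_N exp (C/m E_N - C eps_N t) is nonincreasing.  The resulting bound on Y
   depends neither on M nor on time; choosing M above it, steps of length eta
   show that the truncation is never active. *)

Require Import Defs.
From Stdlib Require Import Reals Lra Lia.
From Coquelicot Require Import Coquelicot.
Open Scope R_scope.

(** * Real analysis *)

Lemma nonincreasing_of_derive (f f' : R -> R) (s t : R) :
  s <= t ->
  (forall x, s <= x <= t -> is_derive f x (f' x)) ->
  (forall x, s <= x <= t -> f' x <= 0) ->
  f t <= f s.
Proof.
  intros st Hd Hneg.
  destruct (MVT_gen f s t f') as [c [Hc E]].
  - intros x; rewrite Rmin_left, Rmax_right by assumption.
    intros Hx; apply Hd; lra.
  - intros x; rewrite Rmin_left, Rmax_right by assumption.
    intros Hx; apply derivable_continuous_pt; exists (f' x).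
    apply is_derive_Reals, Hd; lra.
  - rewrite Rmin_left, Rmax_right in Hc by assumption.
    specialize (Hneg c Hc); nra.
Qed.

(** The integrating factor [exp (c * x)] makes [exp (c * x) * (sg * z x - w x)] nonincreasing for
    both signs [sg]. Here [w] is a supersolution of the damped equation; contraction, decay, growth
    and the vanishing at index 0 below each come from a choice of [w]. *)
Lemma damped_comparison (z z' w w' : R -> R) (c s t : R) :
  s <= t ->
  (forall x, s <= x <= t -> is_derive z x (z' x)) ->
  (forall x, s <= x <= t -> is_derive w x (w' x)) ->
  (forall x, s <= x <= t -> Rabs (z' x + c * z x) <= w' x + c * w x) ->
  Rabs (z s) <= w s ->
  Rabs (z t) <= w t.
Proof.
  intros st Hz Hw Hc Hs.
  assert (half : forall sg, sg = 1 \/ sg = -1 -> sg * z t <= w t).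
  { intros sg Hsg.
    enough (exp (c * t) * (sg * z t - w t) <= exp (c * s) * (sg * z s - w s)) as E.
    { assert (sg * z s - w s <= 0).
      { revert Hs; unfold Rabs; destruct (Rcase_abs (z s)); destruct Hsg; subst; lra. }
      pose proof (exp_pos (c * t)); pose proof (exp_pos (c * s)); nra. }
    apply (nonincreasing_of_derive (fun x => exp (c * x) * (sg * z x - w x))
      (fun x => exp (c * x) * (sg * (z' x + c * z x) - (w' x + c * w x)))); auto.
    - intros x Hx.
      pose proof (Hz x Hx) as dz; pose proof (Hw x Hx) as dw.
      auto_derive.
      + repeat split; [now exists (z' x) | now exists (w' x)].
      + rewrite (is_derive_unique (fun y : R => z y) x _ dz).
        rewrite (is_derive_unique (fun y : R => w y) x _ dw); ring.
    - intros x Hx; specialize (Hc x Hx).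
      assert (sg * (z' x + c * z x) <= Rabs (z' x + c * z x)).
      { unfold Rabs; destruct (Rcase_abs _); destruct Hsg; subst; lra. }
      pose proof (exp_pos (c * x)); nra. }
  apply Rabs_le; split; [specialize (half (-1)) | specialize (half 1)]; lra.
Qed.

Lemma exp_monotone (x y : R) : x <= y -> exp x <= exp y.
Proof. intros [H| ->]; [left; now apply exp_increasing | apply Rle_refl]. Qed.

(** The solution of [x' = - c x + h] with initial value [x0], by variation of constants. *)
Definition duhamel (c x0 : R) (h : R -> R) (t : R) : R :=
  exp (- c * t) * (x0 + RInt (fun s => exp (c * s) * h s) 0 t).

Lemma duhamel_0 (c x0 : R) (h : R -> R) : duhamel c x0 h 0 = x0.
Proof.
  unfold duhamel; rewrite RInt_point, Rmult_0_r, exp_0.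
  change zero with 0; ring.
Qed.

Lemma is_derive_duhamel (c x0 : R) (h : R -> R) (t : R) :
  (forall s, continuous h s) ->
  is_derive (duhamel c x0 h) t (- c * duhamel c x0 h t + h t).
Proof.
  intros Hh.
  set (g := fun s => exp (c * s) * h s).
  assert (Hg : forall s, continuous g s).
  { intros s; apply (continuous_mult (fun s => exp (c * s)) h); auto.
    apply (ex_derive_continuous (fun s => exp (c * s))); auto_derive; auto. }
  assert (dI : is_derive (fun t => RInt g 0 t) t (g t)).
  { apply (is_derive_RInt g _ 0); auto.
    exists (mkposreal _ Rlt_0_1); intros y _.
    apply (RInt_correct (V := R_CompleteNormedModule)).
    now apply (ex_RInt_continuous (V := R_CompleteNormedModule)). }
  unfold duhamel; fold g.
  assert (E : exp (- c * t) * exp (c * t) = 1).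
  { rewrite <- exp_plus, <- exp_0; f_equal; ring. }
  replace (- c * (exp (- c * t) * (x0 + RInt g 0 t)) + h t)
    with (- c * (exp (- c * t) * (x0 + RInt g 0 t)) + exp (- c * t) * g t).
  2:{ unfold g; rewrite <- (Rmult_assoc _ (exp (c * t)) (h t)), E; ring. }
  set (I := fun t => RInt g 0 t) in *.
  change (is_derive (fun t => exp (- c * t) * (x0 + I t)) t
    (- c * (exp (- c * t) * (x0 + I t)) + exp (- c * t) * g t)).
  auto_derive.
  - now exists (g t).
  - rewrite (is_derive_unique (fun x : R => I x) t _ dI); ring.
Qed.

(** The difference starts at zero and solves the damped equation with source [h1 - h2], while
    [M / (c + kappa) * exp (kappa * t)] solves it with source [M * exp (kappa * t)], hence is a
    supersolution. The gain [1 / (c + kappa)] is what the exponential weight in time provides. *)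
Lemma duhamel_dist (c x0 kappa M : R) (h1 h2 : R -> R) (t : R) :
  (forall s, continuous h1 s) -> (forall s, continuous h2 s) ->
  0 < c + kappa -> 0 <= M ->
  (forall s, 0 <= s -> Rabs (h1 s - h2 s) <= M * exp (kappa * s)) ->
  0 <= t ->
  Rabs (duhamel c x0 h1 t - duhamel c x0 h2 t)
    <= M / (c + kappa) * exp (kappa * t).
Proof.
  intros C1 C2 Hck HM Hh Ht.
  apply (damped_comparison
    (fun t => duhamel c x0 h1 t - duhamel c x0 h2 t)
    (fun t => (- c * duhamel c x0 h1 t + h1 t) - (- c * duhamel c x0 h2 t + h2 t))
    (fun t => M / (c + kappa) * exp (kappa * t))
    (fun t => M / (c + kappa) * (kappa * exp (kappa * t))) c 0 t); auto.
  - intros x _; apply (is_derive_minus (V := R_NormedModule)); now apply is_derive_duhamel.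
  - intros x _; auto_derive; auto; ring.
  - intros x Hx.
    replace (_ + _) with (h1 x - h2 x) by ring.
    replace (_ + _) with (M * exp (kappa * x)) by (field; lra).
    apply Hh; lra.
  - rewrite !duhamel_0, Rminus_diag, Rabs_R0.
    pose proof (exp_pos (kappa * 0)).
    apply Rmult_le_pos; [|lra].
    apply Rmult_le_pos; [lra|]; left; now apply Rinv_0_lt_compat.
Qed.

Lemma geometric_limit (u : nat -> R) (D : R) :
  0 <= D ->
  (forall n, Rabs (u (S n) - u n) <= D * (1 / 2) ^ n) ->
  forall n, Rabs (real (Lim_seq u) - u n) <= 2 * D * (1 / 2) ^ n.
Proof.
  intros HD H.
  assert (Hp : forall n, 0 < (1 / 2) ^ n) by (intros; apply pow_lt; lra).
  (* The subtracted term closes the induction on [k]: the increment [D / 2^(n+k)] is exactly the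
     difference of two consecutive right-hand sides. *)
  assert (tail : forall n k, Rabs (u (n + k)%nat - u n) <= 2 * D * (1 / 2) ^ n - 2 * D * (1/2) ^ (n + k)).
  { intros n; induction k as [|k IH].
    - rewrite Nat.add_0_r, Rminus_diag, Rabs_R0; lra.
    - rewrite Nat.add_succ_r.
      replace (u (S (n + k)) - u n) with ((u (S (n + k)) - u (n + k)%nat) + (u (n + k)%nat - u n)) by ring.
      eapply Rle_trans; [apply Rabs_triang|].
      specialize (H (n + k)%nat); simpl pow; lra. }
  assert (ex : ex_finite_lim_seq u).
  { apply ex_lim_seq_cauchy_corr; intros eps.
    assert (L : is_lim_seq (fun n => 2 * D * (1 / 2) ^ n) 0).
    { replace (Finite 0) with (Rbar_mult (2 * D) 0) by (simpl; f_equal; ring).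
      apply is_lim_seq_scal_l, is_lim_seq_geom; rewrite Rabs_pos_eq; lra. }
    apply is_lim_seq_spec in L.
    destruct (L (pos_div_2 eps)) as [N HN].
    exists N; intros n m Hn Hm.
    specialize (HN N (Nat.le_refl N)); rewrite Rminus_0_r in HN.
    apply Rabs_def2 in HN; simpl in HN.
    pose proof (tail N (n - N)%nat) as T1; pose proof (tail N (m - N)%nat) as T2.
    replace (N + (n - N))%nat with n in T1 by lia.
    replace (N + (m - N))%nat with m in T2 by lia.
    pose proof (Rmult_le_pos _ _ HD (Rlt_le _ _ (Hp n))).
    pose proof (Rmult_le_pos _ _ HD (Rlt_le _ _ (Hp m))).
    replace (u n - u m) with ((u n - u N) - (u m - u N)) by ring.
    eapply Rle_lt_trans; [apply Rabs_triang|]; rewrite Rabs_Ropp; lra. }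
  apply Lim_seq_correct' in ex.
  intros n.
  assert (L : is_lim_seq (fun k => Rabs (u (k + n)%nat - u n)) (Rabs (Lim_seq u - u n))).
  { apply (is_lim_seq_abs _ (Finite _)).
    apply is_lim_seq_minus'; [|apply is_lim_seq_const].
    now apply -> (is_lim_seq_incr_n u n). }
  apply (is_lim_seq_le _ (fun _ => 2 * D * (1 / 2) ^ n) _ (Finite (2 * D * (1 / 2) ^ n))) in L.
  - exact L.
  - intros k; rewrite Nat.add_comm.
    pose proof (tail n k); pose proof (Rmult_le_pos _ _ HD (Rlt_le _ _ (Hp (n + k)%nat))); lra.
  - apply is_lim_seq_const.
Qed.

(** The usual eps/3 argument. Closeness is required only within distance 1 of [t0], because the
    error bounds of the Picard iterates grow exponentially in time. *)
Lemma continuous_uniform_limit (f : R -> R) (fn : nat -> R -> R) (M t0 : R) :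
  0 <= M ->
  (forall n, continuous (fn n) t0) ->
  (forall n t, Rabs (t - t0) < 1 -> Rabs (f t - fn n t) <= M * (1 / 2) ^ n) ->
  continuous f t0.
Proof.
  intros HM Hc H.
  apply filterlim_locally; intros eps.
  assert (L : is_lim_seq (fun n => M * (1 / 2) ^ n) 0).
  { replace (Finite 0) with (Rbar_mult M 0) by (simpl; f_equal; ring).
    apply is_lim_seq_scal_l, is_lim_seq_geom; rewrite Rabs_pos_eq; lra. }
  apply is_lim_seq_spec in L.
  assert (He : 0 < eps / 3) by (pose proof (cond_pos eps); lra).
  destruct (L (mkposreal _ He)) as [N HN].
  specialize (HN N (Nat.le_refl N)); rewrite Rminus_0_r in HN.
  apply Rabs_def2 in HN; simpl in HN.
  pose proof (proj1 (filterlim_locally _ _) (Hc N) (mkposreal _ He)) as HcN.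
  pose proof (locally_ball t0 (mkposreal _ Rlt_0_1)) as Hb.
  refine (filter_imp _ _ _ (filter_and _ _ HcN Hb)).
  intros t [B1 B2].
  change (Rabs (fn N t - fn N t0) < eps / 3) in B1.
  change (Rabs (t - t0) < 1) in B2.
  change (Rabs (f t - f t0) < eps).
  pose proof (H N t B2) as E1.
  assert (E2 : Rabs (f t0 - fn N t0) <= M * (1 / 2) ^ N).
  { apply H; rewrite Rminus_diag, Rabs_R0; lra. }
  replace (f t - f t0) with ((f t - fn N t) + (fn N t - fn N t0) - (f t0 - fn N t0)) by ring.
  eapply Rle_lt_trans; [apply Rabs_triang|]; rewrite Rabs_Ropp.
  eapply Rle_lt_trans; [apply Rplus_le_compat_r, Rabs_triang|]; lra.
Qed.

Lemma continuous_Rmax_l (a t : R) : continuous (Rmax a) t.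
Proof.
  apply filterlim_locally; intros eps; exists eps; intros y Hy.
  change (Rabs (y - t) < eps) in Hy.
  change (Rabs (Rmax a y - Rmax a t) < eps).
  revert Hy; unfold Rmax, Rabs.
  destruct (Rle_dec a y), (Rle_dec a t); repeat destruct (Rcase_abs _); lra.
Qed.

(** * Partial sums of nonnegative sequences *)

Lemma sum_n_le_Series (u : nat -> R) (n : nat) :
  (forall k, 0 <= u k) -> ex_series u -> sum_n u n <= Series u.
Proof.
  intros Hp Hu; apply Series_correct in Hu.
  apply (is_lim_seq_incr_compare (sum_n u) _ Hu).
  intros k; rewrite sum_Sn; specialize (Hp (S k)); change plus with Rplus; lra.
Qed.

Lemma term_le_sum_n (u : nat -> R) (j n : nat) :
  (forall k, 0 <= u k) -> (j <= n)%nat -> u j <= sum_n u n.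
Proof.
  intros Hp; induction n as [|n IH]; intros Hj.
  - replace j with 0%nat by lia; rewrite sum_O; lra.
  - rewrite sum_Sn; change plus with Rplus.
    destruct (Nat.eq_dec j (S n)) as [->|Hn].
    + assert (0 <= sum_n u n); [|lra].
      clear IH Hj; induction n as [|n IH]; [rewrite sum_O; auto|].
      rewrite sum_Sn; change plus with Rplus; specialize (Hp (S n)); lra.
    + specialize (Hp (S n)); assert (u j <= sum_n u n) by (apply IH; lia); lra.
Qed.

Lemma sum_n_monotone (u v : nat -> R) (N : nat) :
  (forall k, u k <= v k) -> sum_n u N <= sum_n v N.
Proof.
  intros H; induction N as [|N IH]; [rewrite !sum_O; auto|].
  rewrite !sum_Sn; change plus with Rplus; specialize (H (S N)); lra.
Qed.

Lemma sum_n_nonneg (u : nat -> R) (N : nat) : (forall k, 0 <= u k) -> 0 <= sum_n u N.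
Proof.
  intros H; eapply Rle_trans; [apply (H 0%nat)|]; apply term_le_sum_n; auto; lia.
Qed.

(** * Semilinear systems *)

Fixpoint picard {I : Type} (c x0 : I -> R) (G : I -> (I -> R) -> R)
    (n : nat) (i : I) (t : R) : R :=
  match n with
  | O => 0
  | S m => duhamel (c i) (x0 i) (fun s => G i (fun k => picard c x0 G m k s)) (Rmax 0 t)
  end.

(* The iteration contracts by the factor 1/2 in the norm
   [sup_{i, t >= 0} |u_i(t)| exp (- kappa t) / w_i]; reading the iterates at
   [Rmax 0 t] makes them continuous on the whole line. *)
Lemma semilinear_global_solution (I : Type) (c w x0 : I -> R)
    (G : I -> (I -> R) -> R) (kappa K : R) :
  0 <= kappa -> 0 <= K ->
  (forall i, 0 < c i) -> (forall i, 0 <= w i) ->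
  (forall i, Rabs (x0 i) <= K * w i) ->
  (forall i, G i (fun _ => 0) = 0) ->
  (forall D x y, 0 <= D -> (forall k, Rabs (x k - y k) <= D * w k) ->
     forall i, Rabs (G i x - G i y) <= / 2 * (c i + kappa) * w i * D) ->
  (forall (v : I -> R -> R) (t : R), (forall k, continuous (v k) t) ->
     forall i, continuous (fun s => G i (fun k => v k s)) t) ->
  exists U : I -> R -> R,
    (forall i, U i 0 = x0 i) /\
    (forall i t, 0 <= t ->
       is_derive (U i) t (- c i * U i t + G i (fun k => U k t))).
Proof.
  intros Hk HK Hc Hw Hx0 G0 Glip Gcont.
  assert (Hck : forall i, 0 < c i + kappa) by (intros i; specialize (Hc i); lra).
  assert (Ccomp : forall (f : R -> R) t, (forall s, continuous f s) -> continuous (fun s => f (Rmax 0 s)) t).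
  { intros f t Hf; apply (continuous_comp (Rmax 0) f); [apply continuous_Rmax_l | apply Hf]. }
  assert (Cduh : forall i (h : R -> R), (forall s, continuous h s) ->
    forall s, continuous (duhamel (c i) (x0 i) h) s).
  { intros i h Hh s; apply (ex_derive_continuous (duhamel (c i) (x0 i) h)); eexists; now apply is_derive_duhamel. }
  set (v := picard c x0 G).
  assert (Cv : forall n i (t : R), continuous (v n i) t).
  { induction n as [|n IH]; intros i t; [apply continuous_const|].
    apply Ccomp, Cduh; intros s; apply Gcont; intros k; apply IH. }
  (* The contraction: [Glip] bounds the difference of sources by [/ 2 * (c i + kappa) * w i * D],
     and [duhamel_dist] divides by [c i + kappa]. *)
  assert (Phi : forall (u u' : I -> R -> R) D,
    0 <= D ->
    (forall i t, continuous (u i) t) -> (forall i t, continuous (u' i) t) ->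
    (forall i t, 0 <= t -> Rabs (u i t - u' i t) <= D * w i * exp (kappa * t)) ->
    forall i t, 0 <= t ->
      Rabs (duhamel (c i) (x0 i) (fun s => G i (fun k => u k s)) t
            - duhamel (c i) (x0 i) (fun s => G i (fun k => u' k s)) t)
        <= (D * / 2) * w i * exp (kappa * t)).
  { intros u u' D HD Cu Cu' Huu i t Ht.
    replace (D * / 2 * w i) with (/ 2 * (c i + kappa) * w i * D / (c i + kappa)).
    2:{ field; specialize (Hck i); lra. }
    apply duhamel_dist; auto.
    - specialize (Hck i); specialize (Hw i).
      repeat apply Rmult_le_pos; lra.
    - intros s Hs; rewrite Rmult_assoc.
      apply Glip.
      + apply Rmult_le_pos; [lra|left; apply exp_pos].
      + intros k; eapply Rle_trans; [now apply Huu|]; right; ring. }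
  assert (step : forall n i t, 0 <= t ->
    Rabs (v (S n) i t - v n i t) <= K * (1 / 2) ^ n * w i * exp (kappa * t)).
  { induction n as [|n IH]; intros i t Ht.
    (* The first iterate is the free decay of [x0 i], since [G i] vanishes at zero; it stays below
       [K * w i]. *)
    - change (v 0%nat i t) with 0.
      change (v 1%nat i t) with (duhamel (c i) (x0 i) (fun s => G i (fun _ => 0)) (Rmax 0 t)).
      rewrite Rmax_right, Rminus_0_r by lra.
      assert (E : exp (kappa * t) >= 1).
      { rewrite <- exp_0; apply Rle_ge.
        apply exp_monotone, Rmult_le_pos; lra. }
      apply Rle_trans with (K * w i).
      2:{ pose proof (Rmult_le_pos _ _ HK (Hw i)); simpl; nra. }
      apply (damped_comparison
        (duhamel (c i) (x0 i) (fun s => G i (fun _ => 0)))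
        (fun t => - c i * duhamel (c i) (x0 i) (fun s => G i (fun _ => 0)) t + G i (fun _ => 0))
        (fun _ => K * w i) (fun _ => 0) (c i) 0 t); auto.
      + intros x _; apply (is_derive_duhamel (c i) (x0 i) (fun _ => G i (fun _ => 0))); intros s; apply continuous_const.
      + intros x _; apply (is_derive_const (V := R_NormedModule)).
      + intros x _; rewrite G0.
        replace (_ + _) with 0 by ring; rewrite Rabs_R0.
        pose proof (Rmult_le_pos _ _ HK (Hw i)); specialize (Hc i); nra.
      + rewrite duhamel_0; auto.
    - replace (K * (1 / 2) ^ S n) with (K * (1 / 2) ^ n * / 2) by (simpl; field).
      change (v (S (S n)) i t) with
        (duhamel (c i) (x0 i) (fun s => G i (fun k => v (S n) k s)) (Rmax 0 t)).
      change (v (S n) i t) with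
        (duhamel (c i) (x0 i) (fun s => G i (fun k => v n k s)) (Rmax 0 t)).
      rewrite (Rmax_right 0 t) by lra.
      apply Phi; auto.
      apply Rmult_le_pos; [lra|]; apply pow_le; lra. }
  set (V := fun i t => real (Lim_seq (fun n => v n i (Rmax 0 t)))).
  assert (vV : forall n i t, Rabs (V i t - v n i (Rmax 0 t))
    <= 2 * (K * w i * exp (kappa * Rmax 0 t)) * (1 / 2) ^ n).
  { intros n i t; unfold V.
    apply (geometric_limit (fun n => v n i (Rmax 0 t))).
    - apply Rmult_le_pos; [now apply Rmult_le_pos | left; apply exp_pos].
    - intros m; eapply Rle_trans; [apply step, Rmax_l|]; right; ring. }
  assert (CV : forall i (t : R), continuous (V i) t).
  { intros i t.
    apply (continuous_uniform_limit _ (fun n s => v n i (Rmax 0 s))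
      (2 * (K * w i * exp (kappa * (Rabs t + 1))))).
    - apply Rmult_le_pos; [lra|].
      apply Rmult_le_pos; [now apply Rmult_le_pos | left; apply exp_pos].
    - intros n; apply Ccomp; intros; apply Cv.
    - intros n s Hs; eapply Rle_trans; [apply vV|].
      apply Rmult_le_compat_r; [apply pow_le; lra|].
      apply Rmult_le_compat_l; [lra|].
      apply Rmult_le_compat_l; [now apply Rmult_le_pos|].
      assert (Rmax 0 s <= Rabs t + 1).
      { apply Rabs_def2 in Hs; pose proof (Rle_abs t); pose proof (Rabs_pos t).
        apply Rmax_lub; lra. }
      apply exp_monotone, Rmult_le_compat_l; lra. }
  (* One more application of the Duhamel map, now without [Rmax]: [V] is constant on negative times,
     whereas [U] has a two-sided derivative at 0 as well. *)
  set (U := fun i t => duhamel (c i) (x0 i) (fun s => G i (fun k => V k s)) t).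
  assert (CG : forall i (s : R), continuous (fun s => G i (fun k => V k s)) s).
  { intros i s; apply Gcont; intros; apply CV. }
  assert (UV : forall i t, 0 <= t -> U i t = V i t).
  { intros i t Ht.
    assert (HB : 0 <= K * w i * exp (kappa * t)).
    { apply Rmult_le_pos; [now apply Rmult_le_pos | left; apply exp_pos]. }
    (* Both lie within a multiple of [2^-n] of the iterate [v (S n)]: [V] by its rate of
       convergence, [U] by [Phi] applied to [V] and [v n]. *)
    assert (B : forall n, Rabs (U i t - V i t) <= 2 * (K * w i * exp (kappa * t)) * (1 / 2) ^ n).
    { intros n.
      replace (U i t - V i t) with ((U i t - v (S n) i t) - (V i t - v (S n) i t)) by ring.
      eapply Rle_trans; [apply Rabs_triang|]; rewrite Rabs_Ropp.
      pose proof (vV (S n) i t) as E1; rewrite (Rmax_right 0 t) in E1 by lra.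
      assert (E2 : Rabs (U i t - v (S n) i t)
        <= 2 * K * (1 / 2) ^ n * / 2 * w i * exp (kappa * t)).
      { change (v (S n) i t) with
          (duhamel (c i) (x0 i) (fun s => G i (fun k => v n k s)) (Rmax 0 t)).
        rewrite (Rmax_right 0 t) by lra.
        apply Phi; auto.
        - apply Rmult_le_pos; [lra|]; apply pow_le; lra.
        - intros k s Hs; pose proof (vV n k s) as E; rewrite (Rmax_right 0 s) in E by lra.
          eapply Rle_trans; [exact E|]; right; ring. }
      simpl pow in E1; lra. }
    assert (L : is_lim_seq (fun n => 2 * (K * w i * exp (kappa * t)) * (1 / 2) ^ n) 0).
    { replace (Finite 0) with (Rbar_mult (2 * (K * w i * exp (kappa * t))) 0) by (simpl; f_equal; ring).
      apply is_lim_seq_scal_l, is_lim_seq_geom; rewrite Rabs_pos_eq; lra. }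
    pose proof (is_lim_seq_le _ _ _ _ B (is_lim_seq_const _) L) as Z; simpl in Z.
    pose proof (Rabs_pos (U i t - V i t)).
    destruct (Req_dec (U i t - V i t) 0) as [E|E]; [lra|].
    apply Rabs_no_R0 in E; lra. }
  exists U; split.
  - intros i; apply duhamel_0.
  - intros i t Ht.
    replace (G i (fun k => U k t)) with (G i (fun k => V k t)).
    + now apply is_derive_duhamel.
    (* The Lipschitz bound with [D = 0] carries the equality of the components at time [t] over to
       [G i]. *)
    + apply Rminus_diag_uniq.
      assert (E : Rabs (G i (fun k => V k t) - G i (fun k => U k t)) <= / 2 * (c i + kappa) * w i * 0).
      { apply Glip; [lra|]; intros k; rewrite UV, Rminus_diag, Rabs_R0 by lra; lra. }
      destruct (Req_dec (G i (fun k => V k t) - G i (fun k => U k t)) 0) as [Z|Z]; auto.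
      apply Rabs_no_R0 in Z; pose proof (Rabs_pos (G i (fun k => V k t) - G i (fun k => U k t))); lra.
Qed.

(** * The truncated nonlinearity *)

Definition clip (r x : R) : R := Rmax (- r) (Rmin r x).

Lemma clip_bound (r x : R) : 0 <= r -> Rabs (clip r x) <= r.
Proof.
  intros Hr; apply Rabs_le; unfold clip, Rmax, Rmin.
  destruct (Rle_dec r x); destruct (Rle_dec _ _); lra.
Qed.

Lemma clip_id (r x : R) : Rabs x <= r -> clip r x = x.
Proof.
  intros H; apply Rabs_le_between in H; unfold clip, Rmax, Rmin.
  destruct (Rle_dec r x); destruct (Rle_dec _ _); lra.
Qed.

Lemma clip_lipschitz (r x y : R) : Rabs (clip r x - clip r y) <= Rabs (x - y).
Proof.
  unfold clip, Rmax, Rmin.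
  destruct (Rle_dec r x), (Rle_dec r y); repeat destruct (Rle_dec _ _);
    unfold Rabs; repeat destruct (Rcase_abs _); lra.
Qed.

Lemma continuous_clip (r x : R) : continuous (clip r) x.
Proof.
  apply filterlim_locally; intros eps; exists eps; intros y Hy.
  change (Rabs (y - x) < eps) in Hy.
  change (Rabs (clip r y - clip r x) < eps).
  eapply Rle_lt_trans; [apply clip_lipschitz | exact Hy].
Qed.

(** The threshold [X] solves [X^(2 - theta) = / eps]. Below it monotonicity gives the constant;
    above it [x^theta = x^2 / x^(2 - theta)] is at most [eps * x^2]. *)
Lemma Rpower_le_square (theta eps : R) :
  0 <= theta < 2 -> 0 < eps ->
  exists K, 0 <= K /\ forall x, 1 <= x -> Rpower x theta <= eps * x ^ 2 + K.
Proof.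
  intros Hth Heps.
  set (X := Rpower (/ eps) (/ (2 - theta))).
  exists (Rpower X theta); split; [left; apply exp_pos|].
  intros x Hx.
  destruct (Rle_lt_dec x X) as [H|H].
  - assert (Rpower x theta <= Rpower X theta) by (apply Rle_Rpower_l; lra).
    pose proof (pow2_ge_0 x); nra.
  - assert (E : / eps <= Rpower x (2 - theta)).
    { replace (/ eps) with (Rpower X (2 - theta)).
      - apply Rle_Rpower_l; [lra|]; split; [apply exp_pos | lra].
      - unfold X; rewrite Rpower_mult, Rinv_l, Rpower_1 by (try lra; now apply Rinv_0_lt_compat).
        reflexivity. }
    assert (F : x ^ 2 = Rpower x theta * Rpower x (2 - theta)).
    { rewrite <- Rpower_plus, <- (Rpower_pow 2) by lra; f_equal; simpl; ring. }
    assert (P : 0 < Rpower x theta) by apply exp_pos.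
    assert (Q : 0 < Rpower X theta) by apply exp_pos.
    rewrite F.
    assert (1 <= eps * Rpower x (2 - theta)).
    { replace 1 with (eps * / eps) by (field; lra).
      apply Rmult_le_compat_l; lra. }
    nra.
Qed.

(* The pair [(a, b)] is one family indexed by [bool * nat]: [a_j] is at
   [(true, j)] and [b_j] at [(false, j)]. *)
Definition rhs_nonlin (lam theta d_i : R) (x : bool * nat -> R) (i : bool * nat) : R :=
  let a k := x (true, k) in
  let b k := x (false, k) in
  if fst i then rhs_a lam theta 0 a b (snd i) else rhs_b lam theta 0 d_i a b (snd i).

Definition damping (lam nu mu : R) (i : bool * nat) : R :=
  (if fst i then nu else mu) * (lam ^ snd i) ^ 2.

Definition clipped (lam M : R) (x : bool * nat -> R) (i : bool * nat) : R :=
  clip (M / lam ^ snd i) (x i).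

(** Splitting the difference of products as [(x1 - y1) * x2 + y1 * (x2 - y2)] needs a size bound on
    one factor of each pair only. The weights [p] and [q] are those of the two factors and cancel
    against [c <= B * (p * q)]. *)
Lemma quadratic_term_lipschitz (c M D p q B x1 x2 y1 y2 : R) :
  0 < p -> 0 < q -> 0 <= c -> 0 <= M -> 0 <= D -> c <= B * (p * q) ->
  Rabs y1 <= M / p -> Rabs x2 <= M / q ->
  Rabs (x1 - y1) <= D / p -> Rabs (x2 - y2) <= D / q ->
  Rabs (c * x1 * x2 - c * y1 * y2) <= 2 * M * D * B.
Proof.
  intros Hp Hq Hc HM HD HB Hy1 Hx2 H1 H2.
  replace (c * x1 * x2 - c * y1 * y2) with (c * ((x1 - y1) * x2 + y1 * (x2 - y2))) by ring.
  rewrite Rabs_mult, (Rabs_pos_eq c) by lra.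
  assert (E : Rabs ((x1 - y1) * x2 + y1 * (x2 - y2)) <= D / p * (M / q) + M / p * (D / q)).
  { eapply Rle_trans; [apply Rabs_triang|]; rewrite !Rabs_mult.
    apply Rplus_le_compat; apply Rmult_le_compat; auto using Rabs_pos. }
  apply Rle_trans with (c * (D / p * (M / q) + M / p * (D / q))).
  { now apply Rmult_le_compat_l. }
  apply Rle_trans with (B * (p * q) * (D / p * (M / q) + M / p * (D / q))).
  { apply Rmult_le_compat_r; auto.
    eapply Rle_trans; [apply Rabs_pos | exact E]. }
  right; field; lra.
Qed.

Lemma zero_ext_close (lam D : R) (x y : nat -> R) :
  1 < lam -> 0 <= D ->
  (forall k, Rabs (x k - y k) <= D / lam ^ k) ->
  forall k, Rabs (zero_ext x k - zero_ext y k) <= D / lam ^ k.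
Proof.
  intros Hl HD H [|k]; simpl zero_ext; [|apply H].
  rewrite Rminus_diag, Rabs_R0; simpl; lra.
Qed.

Lemma zero_ext_bound (lam M : R) (x : nat -> R) :
  1 < lam -> 0 <= M ->
  (forall k, Rabs (x k) <= M / lam ^ k) ->
  forall k, Rabs (zero_ext x k) <= M / lam ^ k.
Proof.
  intros Hl HM H [|k]; simpl zero_ext; [|apply H].
  rewrite Rabs_R0; simpl; lra.
Qed.

Lemma pow_ge_1 (lam : R) (j : nat) : 1 < lam -> 1 <= lam ^ j.
Proof. intros; apply pow_R1_Rle; lra. Qed.

Lemma pow_pred_bounds (lam : R) (j : nat) :
  1 < lam -> lam ^ pred j <= lam ^ j <= lam * lam ^ pred j.
Proof.
  intros Hl; destruct j as [|j]; simpl; [lra|].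
  pose proof (pow_ge_1 lam j Hl); nra.
Qed.

Lemma Rpower_succ (x theta : R) : 0 < x -> Rpower x (theta + 1) = Rpower x theta * x.
Proof. intros; rewrite Rpower_plus, Rpower_1; auto. Qed.

(** The Hall terms are the worst: [lambda_j^(theta + 1)] against two weights of order [lambda_j^-1]
    leaves [lambda_j^(theta - 1)], a loss of [lambda_j^theta] relative to the weight [lambda_j^-1].
    The factor [lam ^ 2] pays for the shift from [j] to [pred j]. *)
Lemma rhs_nonlin_lipschitz (lam theta d_i M D : R) (x y : bool * nat -> R) :
  1 < lam -> 0 <= theta -> 0 <= d_i -> 0 <= M -> 0 <= D ->
  (forall k, Rabs (x k) <= M / lam ^ snd k) ->
  (forall k, Rabs (y k) <= M / lam ^ snd k) ->
  (forall k, Rabs (x k - y k) <= D / lam ^ snd k) ->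
  forall i, Rabs (rhs_nonlin lam theta d_i x i - rhs_nonlin lam theta d_i y i)
    <= 8 * (1 + d_i) * lam ^ 2 * M * D * (Rpower (lam ^ snd i) theta / lam ^ snd i).
Proof.
  intros Hl Hth Hd HM HD Hx Hy Hxy [s j].
  assert (xa := zero_ext_bound lam M (fun k => x (true, k)) Hl HM (fun k => Hx (true, k))).
  assert (xb := zero_ext_bound lam M (fun k => x (false, k)) Hl HM (fun k => Hx (false, k))).
  assert (ya := zero_ext_bound lam M (fun k => y (true, k)) Hl HM (fun k => Hy (true, k))).
  assert (yb := zero_ext_bound lam M (fun k => y (false, k)) Hl HM (fun k => Hy (false, k))).
  assert (da := zero_ext_close lam D (fun k => x (true, k)) (fun k => y (true, k)) Hl HD (fun k => Hxy (true, k))).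
  assert (db := zero_ext_close lam D (fun k => x (false, k)) (fun k => y (false, k)) Hl HD (fun k => Hxy (false, k))).
  set (xA := zero_ext (fun k => x (true, k))) in *.
  set (xB := zero_ext (fun k => x (false, k))) in *.
  set (yA := zero_ext (fun k => y (true, k))) in *.
  set (yB := zero_ext (fun k => y (false, k))) in *.
  simpl snd.
  set (P := Rpower (lam ^ j) theta); set (Pp := Rpower (lam ^ pred j) theta).
  set (l := lam ^ j) in *; set (lp := lam ^ pred j) in *.
  assert (Hlp : 1 <= lp) by now apply pow_ge_1.
  destruct (pow_pred_bounds lam j Hl) as [L1 L2]; fold l lp in L1, L2.
  assert (Ls : lam ^ S j = lam * l) by reflexivity.
  assert (HPp : 0 < Pp) by apply exp_pos.
  assert (HP : Pp <= P) by (apply Rle_Rpower_l; lra).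
  set (B := lam ^ 2 * (P / l)).
  assert (HBl : B * l = lam ^ 2 * P) by (unfold B; field; lra).
  assert (HB : 0 < B).
  { unfold B; apply Rmult_lt_0_compat; [apply pow_lt; lra|].
    apply Rdiv_lt_0_compat; lra. }
  assert (HBlp : P <= B * lp).
  { apply Rle_trans with (lam * P); [nra|].
    apply (Rmult_le_reg_l lam); [lra|].
    replace (lam * (lam * P)) with (B * l) by (rewrite HBl; ring).
    replace (lam * (B * lp)) with (B * (lam * lp)) by ring.
    apply Rmult_le_compat_l; lra. }
  assert (Bs2 : P <= B * l) by (apply Rle_trans with (B * lp); nra).
  assert (Bs1 : P <= lam * (B * l)) by nra.
  assert (T1 : forall u v u' v', (forall k, Rabs (u k) <= M / lam ^ k) -> (forall k, Rabs (v' k) <= M / lam ^ k) ->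
     (forall k, Rabs (u' k - u k) <= D / lam ^ k) -> (forall k, Rabs (v' k - v k) <= D / lam ^ k) ->
     Rabs (P * u' j * v' (S j) - P * u j * v (S j)) <= 2 * M * D * B).
  { intros u v u' v' h1 h2 h3 h4; apply (quadratic_term_lipschitz P M D l (lam ^ S j)); auto.
    - lra. - rewrite Ls; nra. - lra.
    - rewrite Ls; nra. }
  assert (T2 : forall u u', (forall k, Rabs (u k) <= M / lam ^ k) -> (forall k, Rabs (u' k) <= M / lam ^ k) ->
     (forall k, Rabs (u' k - u k) <= D / lam ^ k) ->
     Rabs (Pp * u' (pred j) * u' (pred j) - Pp * u (pred j) * u (pred j)) <= 2 * M * D * B).
  { intros u u' h1 h2 h3; apply (quadratic_term_lipschitz Pp M D lp lp); auto; try lra.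
    nra. }
  assert (T3 : forall u u', (forall k, Rabs (u k) <= M / lam ^ k) -> (forall k, Rabs (u' k) <= M / lam ^ k) ->
     (forall k, Rabs (u' k - u k) <= D / lam ^ k) ->
     Rabs (P * l * u' j * u' (S j) - P * l * u j * u (S j)) <= 2 * M * D * B).
  { intros u u' h1 h2 h3; apply (quadratic_term_lipschitz (P * l) M D l (lam ^ S j)); auto.
    - lra. - rewrite Ls; nra. - nra.
    - rewrite Ls; replace (B * (l * (lam * l))) with ((lam * (B * l)) * l) by ring.
      apply Rmult_le_compat_r; lra. }
  assert (T4 : forall u u', (forall k, Rabs (u k) <= M / lam ^ k) -> (forall k, Rabs (u' k) <= M / lam ^ k) ->
     (forall k, Rabs (u' k - u k) <= D / lam ^ k) ->
     Rabs (Pp * lp * u' (pred j) * u' (pred j) - Pp * lp * u (pred j) * u (pred j)) <= 2 * M * D * B).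
  { intros u u' h1 h2 h3; apply (quadratic_term_lipschitz (Pp * lp) M D lp lp); auto; try lra.
    - apply Rmult_le_pos; lra.
    - replace (B * (lp * lp)) with ((B * lp) * lp) by ring.
      apply Rmult_le_compat_r; lra. }
  (* Each quadratic term costs [2 * M * D * B]. The first equation has four of them, the second two
     plus two with the factor [d_i]; [4 * (1 + d_i)] covers both counts. *)
  replace (8 * (1 + d_i) * lam ^ 2 * M * D * (P / l)) with (4 * (1 + d_i) * (2 * M * D * B))
    by (unfold B; ring).
  assert (N : 0 <= 2 * M * D * B) 
    by (apply Rmult_le_pos; [apply Rmult_le_pos; [apply Rmult_le_pos|]|]; lra).
  unfold rhs_nonlin; destruct s; simpl fst; cbv iota; simpl snd.
  - unfold rhs_a; fold xA xB yA yB; fold l lp P Pp.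
    pose proof (T1 yA yA xA xA ya xa da da) as R1.
    pose proof (T2 yA xA ya xa da) as R2.
    pose proof (T1 yB yB xB xB yb xb db db) as R3.
    pose proof (T2 yB xB yb xb db) as R4.
    set (N0 := 2 * M * D * B) in *; clearbody N0.
    apply Rabs_le_between in R1, R2, R3, R4; apply Rabs_le.
    assert (0 <= d_i * N0) by now apply Rmult_le_pos.
    simpl pow; lra.
  - unfold rhs_b; fold xA xB yA yB; fold l lp.
    rewrite !Rpower_succ by lra; fold P Pp.
    pose proof (T1 yA yB xA xB ya xb da db) as R1.
    pose proof (T1 yB yA xB xA yb xa db da) as R2.
    pose proof (T3 yB xB yb xb db) as R3.
    pose proof (T4 yB xB yb xb db) as R4.
    set (N0 := 2 * M * D * B) in *; clearbody N0.
    apply Rabs_le_between in R1, R2, R3, R4; apply Rabs_le.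
    set (q1 := P * l * xB j * xB (S j) - P * l * yB j * yB (S j)) in *.
    set (q2 := Pp * lp * xB (pred j) * xB (pred j) - Pp * lp * yB (pred j) * yB (pred j)) in *.
    match goal with |- _ <= ?E <= _ =>
      replace E with (- (P * xA j * xB (S j) - P * yA j * yB (S j))
        + (P * xB j * xA (S j) - P * yB j * yA (S j)) - d_i * (q1 - q2))
        by (unfold q1, q2; ring) end.
    clearbody q1 q2.
    assert (Q : - (2 * N0) <= q1 - q2 <= 2 * N0) by lra.
    assert (- (d_i * (2 * N0)) <= d_i * (q1 - q2) <= d_i * (2 * N0)) by (split; nra).
    assert (0 <= d_i * N0) by now apply Rmult_le_pos.
    lra.
Qed.

Lemma rhs_nonlin_0 (lam theta d_i : R) (i : bool * nat) :
  rhs_nonlin lam theta d_i (fun _ => 0) i = 0.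
Proof.
  destruct i as [[|] [|[|j]]]; unfold rhs_nonlin, rhs_a, rhs_b; simpl; ring.
Qed.

Lemma rhs_nonlin_bound (lam theta d_i M : R) (x : bool * nat -> R) :
  1 < lam -> 0 <= theta -> 0 <= d_i -> 0 <= M ->
  (forall k, Rabs (x k) <= M / lam ^ snd k) ->
  forall i, Rabs (rhs_nonlin lam theta d_i x i)
    <= 8 * (1 + d_i) * lam ^ 2 * M * M * (Rpower (lam ^ snd i) theta / lam ^ snd i).
Proof.
  intros Hl Hth Hd HM Hx i.
  rewrite <- (Rminus_0_r (rhs_nonlin lam theta d_i x i)), <- (rhs_nonlin_0 lam theta d_i i).
  apply rhs_nonlin_lipschitz; auto.
  - intros k; rewrite Rabs_R0; eapply Rle_trans; [apply Rabs_pos | apply Hx].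
  - intros k; rewrite Rminus_0_r; apply Hx.
Qed.

Lemma continuous_zero_ext (v : nat -> R -> R) (j : nat) (t : R) :
  (forall k, continuous (v k) t) -> continuous (fun s => zero_ext (fun k => v k s) j) t.
Proof. intros H; destruct j; simpl; [apply continuous_const | apply H]. Qed.

Lemma continuous_rhs_nonlin (lam theta d_i : R) (v : bool * nat -> R -> R) (t : R) :
  (forall k, continuous (v k) t) ->
  forall i, continuous (fun s => rhs_nonlin lam theta d_i (fun k => v k s) i) t.
Proof.
  intros Hv [s j].
  assert (Ha := fun j => continuous_zero_ext (fun k => v (true, k)) j t (fun k => Hv _)).
  assert (Hb := fun j => continuous_zero_ext (fun k => v (false, k)) j t (fun k => Hv _)).
  unfold rhs_nonlin; destruct s; simpl fst; cbv iota; simpl snd; [unfold rhs_a | unfold rhs_b];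
    simpl pow;
    repeat match goal with
      | |- continuous (fun s => zero_ext (fun k => v (true, k) s) _) _ => apply Ha
      | |- continuous (fun s => zero_ext (fun k => v (false, k) s) _) _ => apply Hb
      | |- continuous (fun s => _ - _) _ => apply (continuous_minus (V := R_NormedModule))
      | |- continuous (fun s => _ + _) _ => apply (continuous_plus (V := R_NormedModule))
      | |- continuous (fun s => _ * _) _ => apply (continuous_mult (K := R_AbsRing))
      | _ => apply continuous_const
      end.
Qed.

(** * The truncated system *)

Lemma clipped_bound (lam M : R) (x : bool * nat -> R) :
  1 < lam -> 0 <= M -> forall i, Rabs (clipped lam M x i) <= M / lam ^ snd i.
Proof.
  intros Hl HM i; apply clip_bound, Rdiv_le_0_compat; auto; apply pow_lt; lra.
Qed.

Definition clipped_solution (lam theta nu mu d_i M : R) (x0 : bool * nat -> R)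
    (U : bool * nat -> R -> R) : Prop :=
  (forall i, U i 0 = x0 i) /\
  (forall i t, 0 <= t ->
     is_derive (U i) t (- damping lam nu mu i * U i t
       + rhs_nonlin lam theta d_i (clipped lam M (fun k => U k t)) i)).

Lemma damping_ge (lam nu mu : R) (i : bool * nat) :
  Rmin nu mu * (lam ^ snd i) ^ 2 <= damping lam nu mu i.
Proof.
  apply Rmult_le_compat_r; [apply pow2_ge_0|].
  destruct (fst i); [apply Rmin_l | apply Rmin_r].
Qed.

Lemma clipped_global_solution (lam theta nu mu d_i M K : R) (x0 : bool * nat -> R) :
  1 < lam -> 0 <= theta < 2 -> 0 < nu -> 0 < mu -> 0 <= d_i -> 0 <= M -> 0 <= K ->
  (forall i, Rabs (x0 i) <= K / lam ^ snd i) ->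
  exists U, clipped_solution lam theta nu mu d_i M x0 U.
Proof.
  intros Hl Hth Hnu Hmu Hd HM HK Hx0.
  assert (Hm : 0 < Rmin nu mu) by now apply Rmin_pos.
  assert (Hp : forall i : bool * nat, 1 <= lam ^ snd i) by (intros; now apply pow_ge_1).
  set (C := 8 * (1 + d_i) * lam ^ 2 * M).
  assert (HC : 0 <= C).
  { unfold C; pose proof (pow2_ge_0 lam); repeat apply Rmult_le_pos; lra. }
  (* With this choice [C * lambda_j^theta] is at most half of the damping plus [C * kap], so
     [kappa = 2 * C * kap] gives the contraction factor 1/2. The [+ 1] keeps the denominator
     positive when [M = 0]. *)
  destruct (Rpower_le_square theta (Rmin nu mu / (2 * (C + 1)))) as [kap [Hk Y]]; auto.
  { apply Rdiv_lt_0_compat; lra. }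
  destruct (semilinear_global_solution _ (damping lam nu mu) (fun i => / lam ^ snd i) x0
    (fun i x => rhs_nonlin lam theta d_i (clipped lam M x) i) (2 * C * kap) K)
    as [U [U0 HU]]; auto.
  - repeat apply Rmult_le_pos; lra.
  - intros i; eapply Rlt_le_trans; [|apply damping_ge].
    apply Rmult_lt_0_compat; auto; apply pow_lt; specialize (Hp i); lra.
  - intros i; left; apply Rinv_0_lt_compat; specialize (Hp i); lra.
  - intros i; apply eq_trans with (2 := rhs_nonlin_0 lam theta d_i i).
    apply Rminus_diag_uniq.
    assert (E : Rabs (rhs_nonlin lam theta d_i (clipped lam M (fun _ => 0)) i
      - rhs_nonlin lam theta d_i (fun _ => 0) i)
      <= 8 * (1 + d_i) * lam ^ 2 * M * 0 * (Rpower (lam ^ snd i) theta / lam ^ snd i)).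
    { assert (Z : forall k : bool * nat, Rabs 0 <= M / lam ^ snd k).
      { intros k; rewrite Rabs_R0; apply Rdiv_le_0_compat; auto; specialize (Hp k); lra. }
      apply rhs_nonlin_lipschitz; auto; try lra.
      - now apply clipped_bound.
      - intros k; unfold clipped; rewrite clip_id by apply Z.
        rewrite Rminus_diag, Rabs_R0; unfold Rdiv; lra. }
    rewrite Rmult_0_r, Rmult_0_l in E.
    match goal with |- ?e = 0 => destruct (Req_dec e 0) as [Z|Z]; auto;
      apply Rabs_pos_lt in Z end; lra.
  - intros D x y HD Hxy i.
    eapply Rle_trans.
    + apply (rhs_nonlin_lipschitz lam theta d_i M D); auto; try lra.
      * now apply clipped_bound.
      * now apply clipped_bound.
      * intros k; eapply Rle_trans; [apply clip_lipschitz | apply Hxy].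
    + fold C; specialize (Hp i); pose proof (damping_ge lam nu mu i) as Dp.
      specialize (Y _ Hp); set (l := lam ^ snd i) in *; set (P := Rpower l theta) in *.
      assert (E : C * P <= / 2 * (damping lam nu mu i + 2 * C * kap)).
      { apply Rle_trans with (C * (Rmin nu mu / (2 * (C + 1)) * l ^ 2 + kap)).
        - now apply Rmult_le_compat_l.
        - assert (F : C * (Rmin nu mu / (2 * (C + 1))) <= / 2 * Rmin nu mu).
          { apply Rmult_le_reg_r with (2 * (C + 1)); [lra|].
            replace (C * (Rmin nu mu / (2 * (C + 1))) * (2 * (C + 1))) with (C * Rmin nu mu) by (field; lra).
            nra. }
          assert (0 <= l ^ 2) by apply pow2_ge_0; nra. }
      replace (C * D * (P / l)) with (C * P * (/ l * D)) by (field; lra).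
      replace (/ 2 * (damping lam nu mu i + 2 * C * kap) * / l * D)
        with (/ 2 * (damping lam nu mu i + 2 * C * kap) * (/ l * D)) by ring.
      apply Rmult_le_compat_r; auto.
      apply Rmult_le_pos; auto; left; apply Rinv_0_lt_compat; lra.
  - intros v t Hv i.
    apply (continuous_rhs_nonlin lam theta d_i (fun k s => clip (M / lam ^ snd k) (v k s))).
    intros k; apply (continuous_comp (v k) (clip _)); [apply Hv | apply continuous_clip].
  - exists U; split; auto.
Qed.

(** The clipped source is at most [C * lambda_j^(theta - 1)] and the damping at least
    [Rmin nu mu * lambda_j^2], so the constant [|x0 i|] plus their quotient, of order
    [lambda_j^(theta - 3)], is a supersolution. [K] does not depend on time. *)
Lemma clipped_solution_decay (lam theta nu mu d_i M : R) (x0 : bool * nat -> R) U :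
  1 < lam -> 0 <= theta -> 0 < nu -> 0 < mu -> 0 <= d_i -> 0 <= M ->
  clipped_solution lam theta nu mu d_i M x0 U ->
  exists K, 0 <= K /\ forall i t, 0 <= t ->
    lam ^ snd i * Rabs (U i t)
      <= lam ^ snd i * Rabs (x0 i) + K * Rpower lam (theta - 2) ^ snd i.
Proof.
  intros Hl Hth Hnu Hmu Hd HM [U0 HU].
  assert (Hm : 0 < Rmin nu mu) by now apply Rmin_pos.
  set (C := 8 * (1 + d_i) * lam ^ 2 * M * M).
  assert (HC : 0 <= C).
  { unfold C; pose proof (pow2_ge_0 lam); repeat apply Rmult_le_pos; lra. }
  exists (C / Rmin nu mu); split; [now apply Rdiv_le_0_compat|].
  intros i t Ht.
  assert (Hp : 1 <= lam ^ snd i) by now apply pow_ge_1.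
  pose proof (damping_ge lam nu mu i) as Dp.
  assert (Pw : Rpower lam (theta - 2) ^ snd i = Rpower (lam ^ snd i) theta / (lam ^ snd i) ^ 2).
  { rewrite <- (Rpower_pow (snd i) (Rpower _ _)) by apply exp_pos.
    rewrite <- (Rpower_pow 2 (lam ^ snd i)), <- !(Rpower_pow (snd i) lam) by lra.
    unfold Rdiv; rewrite <- Rpower_Ropp, !Rpower_mult, <- Rpower_plus.
    f_equal; simpl; ring. }
  rewrite Pw.
  set (l := lam ^ snd i) in *; set (P := Rpower l theta).
  assert (HP : 0 < P) by apply exp_pos.
  assert (Hl2 : 0 < l ^ 2) by (apply pow_lt; lra).
  set (W := Rabs (x0 i) + C / Rmin nu mu * (P / l ^ 3)).
  assert (HW : C * (P / l) <= damping lam nu mu i * W).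
  { apply Rle_trans with (Rmin nu mu * l ^ 2 * (C / Rmin nu mu * (P / l ^ 3))).
    - right; field; lra.
    - assert (0 <= C / Rmin nu mu * (P / l ^ 3)).
      { apply Rmult_le_pos; apply Rdiv_le_0_compat; try lra; apply pow_lt; lra. }
      apply Rmult_le_compat; auto; [nra|].
      unfold W; pose proof (Rabs_pos (x0 i)); lra. }
  replace (l * Rabs (x0 i) + C / Rmin nu mu * (P / l ^ 2)) with (l * W) by (unfold W; field; lra).
  apply Rmult_le_compat_l; [lra|].
  apply (damped_comparison (U i) (fun t => - damping lam nu mu i * U i t
       + rhs_nonlin lam theta d_i (clipped lam M (fun k => U k t)) i)
    (fun _ => W) (fun _ => 0) (damping lam nu mu i) 0 t); auto.
  - intros x Hx; apply HU; lra.
  - intros x _; apply (is_derive_const (V := R_NormedModule)).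
  - intros x Hx.
    replace (_ + _) with (rhs_nonlin lam theta d_i (clipped lam M (fun k => U k x)) i) by ring.
    eapply Rle_trans.
    + apply (rhs_nonlin_bound lam theta d_i M); auto; now apply clipped_bound.
    + fold C l P; lra.
  - rewrite U0; unfold W.
    assert (0 <= C / Rmin nu mu * (P / l ^ 3)); [|lra].
    apply Rmult_le_pos; apply Rdiv_le_0_compat; try lra; apply pow_lt; lra.
Qed.

(** The length [eta] is chosen before [A] and [s], which is what allows steps of fixed length to
    reach every time. *)
Lemma clipped_solution_growth (lam theta nu mu d_i M : R) (x0 : bool * nat -> R) U :
  1 < lam -> 0 <= theta < 2 -> 0 < nu -> 0 < mu -> 0 <= d_i -> 0 <= M ->
  clipped_solution lam theta nu mu d_i M x0 U ->
  exists eta, 0 < eta /\ forall A s t, 0 <= A -> 0 <= s <= t -> t <= s + eta ->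
    (forall i, Rabs (U i s) <= A / lam ^ snd i) ->
    forall i, Rabs (U i t) <= (A + 1) / lam ^ snd i.
Proof.
  intros Hl Hth Hnu Hmu Hd HM [U0 HU].
  assert (Hm : 0 < Rmin nu mu) by now apply Rmin_pos.
  set (C := 8 * (1 + d_i) * lam ^ 2 * M * M).
  assert (HC : 0 <= C).
  { unfold C; pose proof (pow2_ge_0 lam); repeat apply Rmult_le_pos; lra. }
  set (eps := Rmin nu mu / (2 * (C + 1))).
  assert (Heps : 0 < eps) by (apply Rdiv_lt_0_compat; lra).
  destruct (Rpower_le_square theta eps) as [K [HK Y]]; auto.
  assert (HCK : 0 <= C * K) by now apply Rmult_le_pos.
  exists (/ (2 * (C * K + 1))); split; [apply Rinv_0_lt_compat; lra|].
  intros A s t HA [Hs Hst] Ht HUs i.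
  assert (Hp : 1 <= lam ^ snd i) by now apply pow_ge_1.
  pose proof (damping_ge lam nu mu i) as Dp.
  specialize (Y _ Hp).
  set (l := lam ^ snd i) in *; set (P := Rpower l theta) in *.
  set (c := damping lam nu mu i) in *.
  (* The source splits into a part at most half of the damping coefficient over [l], balanced by the
     constant [/ 2 / l], and a part [C * K / l], balanced by the slope. Over a time [eta] the slope
     contributes at most another [/ 2 / l]. *)
  set (w := fun x => A / l + / 2 / l + C * K / l * (x - s)).
  assert (Hil : 0 < / l) by (apply Rinv_0_lt_compat; lra).
  apply Rle_trans with (w t).
  - apply (damped_comparison (U i) (fun t => - c * U i t
         + rhs_nonlin lam theta d_i (clipped lam M (fun k => U k t)) i)
      w (fun _ => C * K / l) c s t); auto.
    + intros x Hx; apply HU; lra.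
    + intros x _; unfold w; auto_derive; auto; ring.
    + intros x Hx.
      replace (- c * U i x + _ + _)
        with (rhs_nonlin lam theta d_i (clipped lam M (fun k => U k x)) i) by ring.
      eapply Rle_trans.
      * apply (rhs_nonlin_bound lam theta d_i M); auto; [lra|]; now apply clipped_bound.
      * fold C l P.
        assert (E1 : C * (P / l) <= C * eps * l ^ 2 * / l + C * K / l).
        { replace (C * (P / l)) with (C * P * / l) by (field; lra).
          replace (C * eps * l ^ 2 * / l + C * K / l) with (C * (eps * l ^ 2 + K) * / l) by (field; lra).
          apply Rmult_le_compat_r; [lra|]; now apply Rmult_le_compat_l. }
        assert (E2 : C * eps <= / 2 * Rmin nu mu).
        { unfold eps; apply Rmult_le_reg_r with (2 * (C + 1)); [lra|].
          replace (C * (Rmin nu mu / (2 * (C + 1))) * (2 * (C + 1))) with (C * Rmin nu mu) by (field; lra).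
          nra. }
        assert (E3 : C * eps * l ^ 2 <= / 2 * c).
        { assert (0 <= l ^ 2) by apply pow2_ge_0; nra. }
        assert (E4 : C * eps * l ^ 2 * / l <= c * (/ 2 / l)).
        { replace (c * (/ 2 / l)) with (/ 2 * c * / l) by (field; lra).
          apply Rmult_le_compat_r; lra. }
        assert (E5 : 0 <= A / l + C * K / l * (x - s)).
        { apply Rplus_le_le_0_compat; repeat apply Rmult_le_pos; lra. }
        assert (E6 : 0 <= c).
        { eapply Rle_trans; [|apply Dp]; apply Rmult_le_pos; [lra|apply pow2_ge_0]. }
        unfold w; nra.
    + unfold w; rewrite Rminus_diag, Rmult_0_r; eapply Rle_trans; [apply HUs|].
      fold l; unfold Rdiv; lra.
  - unfold w.
    assert (E : C * K * (t - s) <= / 2).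
    { apply Rle_trans with ((C * K + 1) * / (2 * (C * K + 1))).
      - apply Rmult_le_compat; lra.
      - right; field; lra. }
    replace (A / l + / 2 / l + C * K / l * (t - s)) with ((A + / 2 + C * K * (t - s)) * / l) by (field; lra).
    apply Rmult_le_compat_r; lra.
Qed.

(** * Strong solutions *)

Lemma D_in_of_is_derive (f f' : R -> R) (D : R -> Prop) (t : R) :
  is_derive f t (f' t) -> D_in f f' D t.
Proof.
  intros H; apply is_derive_Reals in H; intros eps Heps.
  destruct (H eps Heps) as [del Hdel].
  exists del; split; [apply cond_pos|].
  intros x [[_ Hx] Hd]; simpl in Hd |- *; unfold R_dist in *.
  specialize (Hdel (x - t)); rewrite Rplus_minus in Hdel.
  apply Hdel; auto; lra.
Qed.

Lemma continue_in_of_continuous (f : R -> R) (D : R -> Prop) (t : R) :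
  continuous f t -> continue_in f D t.
Proof.
  intros H eps Heps.
  destruct (proj1 (filterlim_locally _ _) H (mkposreal eps Heps)) as [del Hdel].
  exists del; split; [apply cond_pos|].
  intros x [_ Hx]; apply Hdel, Hx.
Qed.

(** * Bounds in H^1 that are uniform in time *)

Lemma Hs_term_1 (lam : R) (u : nat -> R) (n : nat) :
  1 < lam -> Hs_term lam 1 u n = (lam ^ n * u n) ^ 2.
Proof.
  intros Hl; unfold Hs_term.
  replace (2 * 1) with (INR 2) by (simpl; ring).
  rewrite Rpower_pow by (apply pow_lt; lra); ring.
Qed.

Lemma in_l2_of_H1 (lam : R) (u : nat -> R) : 1 < lam -> in_Hs lam 1 u -> in_l2 u.
Proof.
  intros Hl; apply (ex_series_le (K := R_AbsRing) (V := R_CompleteNormedModule)).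
  intros n; rewrite Hs_term_1 by assumption.
  change (Rabs (u (S n) ^ 2) <= (lam ^ S n * u (S n)) ^ 2).
  rewrite Rabs_pos_eq, Rpow_mult_distr by apply pow2_ge_0.
  pose proof (pow_ge_1 lam (S n) Hl); pose proof (pow2_ge_0 (u (S n))).
  assert (1 <= (lam ^ S n) ^ 2) by (apply pow_R1_Rle; lra); nra.
Qed.

(** This is [(q + r)^2 <= 2 q^2 + 2 r^2] for the two terms of the bound in [clipped_solution_decay].
    Summable and independent of time, it bounds the H^1 norm, and later the enstrophy of a far shell
    at all times. *)
Definition H1_majorant (lam rho K : R) (v : nat -> R) (k : nat) : R :=
  2 * Hs_term lam 1 v (S k) + 2 * K ^ 2 * (rho ^ 2) ^ S k.

Lemma ex_series_H1_majorant (lam rho K : R) (v : nat -> R) :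
  0 <= rho < 1 -> in_Hs lam 1 v -> ex_series (H1_majorant lam rho K v).
Proof.
  intros Hr Hv.
  apply (ex_series_plus (V := R_NormedModule) (fun k => 2 * Hs_term lam 1 v (S k)) (fun k => 2 * K ^ 2 * (rho ^ 2) ^ S k)).
  - now apply (ex_series_scal (V := R_NormedModule) 2).
  - apply (ex_series_scal (V := R_NormedModule) (2 * K ^ 2)).
    apply (ex_series_incr_1 (V := R_NormedModule) (fun n => (rho ^ 2) ^ n)), ex_series_geom.
    rewrite Rabs_pos_eq by apply pow2_ge_0; nra.
Qed.

Lemma Hs_term_majorant (lam rho K : R) (u v : nat -> R) (k : nat) :
  1 < lam ->
  lam ^ S k * Rabs (u (S k)) <= lam ^ S k * Rabs (v (S k)) + K * rho ^ S k ->
  0 <= Hs_term lam 1 u (S k) <= H1_majorant lam rho K v k.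
Proof.
  intros Hl H; unfold H1_majorant; rewrite !Hs_term_1 by assumption.
  assert (Hp : 0 < lam ^ S k) by (apply pow_lt; lra).
  split; [apply pow2_ge_0|].
  replace ((rho ^ 2) ^ S k) with ((rho ^ S k) ^ 2) by (rewrite <- !pow_mult; f_equal; lia).
  rewrite !Rpow_mult_distr, <- (pow2_abs (u (S k))), <- (pow2_abs (v (S k))), <- !Rpow_mult_distr.
  set (p := lam ^ S k * Rabs (u (S k))) in *; set (q := lam ^ S k * Rabs (v (S k))) in *.
  assert (0 <= p) by (apply Rmult_le_pos; [lra | apply Rabs_pos]).
  replace (2 * q ^ 2 + 2 * K ^ 2 * (rho ^ S k) ^ 2) with (2 * q ^ 2 + 2 * (K * rho ^ S k) ^ 2) by ring.
  set (r := K * rho ^ S k) in *.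
  assert (p ^ 2 <= (q + r) ^ 2) by (apply pow_incr; lra).
  pose proof (pow2_ge_0 (q - r)); nra.
Qed.

Lemma H1_bounded_of_majorant (lam rho K : R) (v : nat -> R) (D : R -> Prop) (u : R -> nat -> R) :
  1 < lam -> 0 <= rho < 1 -> in_Hs lam 1 v ->
  (forall t j, D t -> lam ^ j * Rabs (u t j) <= lam ^ j * Rabs (zero_ext v j) + K * rho ^ j) ->
  Hs_bounded_on lam 1 D u.
Proof.
  intros Hl Hr Hv H.
  pose proof (ex_series_H1_majorant lam rho K v Hr Hv) as Hm.
  exists (sqrt (Series (H1_majorant lam rho K v))); intros t Dt.
  assert (B := fun k => Hs_term_majorant lam rho K (u t) v k Hl (H t (S k) Dt)).
  split.
  - apply (ex_series_le (K := R_AbsRing) (V := R_CompleteNormedModule) _ (H1_majorant lam rho K v)); auto.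
    intros n; change (Rabs (Hs_term lam 1 (u t) (S n)) <= H1_majorant lam rho K v n).
    rewrite Rabs_pos_eq; apply B.
  - apply sqrt_le_1_alt, Series_le; auto.
Qed.

(** Applying [zero_ext] discards the meaningless values at index 0, so the weighted bounds hold
    there too and these components stay zero. *)
Definition pair_family (a b : nat -> R) (i : bool * nat) : R :=
  zero_ext (if fst i then a else b) (snd i).

Lemma rhs_a_split (lam theta nu d_i : R) (x : bool * nat -> R) (j : nat) :
  (1 <= j)%nat ->
  rhs_a lam theta nu (fun k => x (true, k)) (fun k => x (false, k)) j
    = - (nu * (lam ^ j) ^ 2) * x (true, j) + rhs_nonlin lam theta d_i x (true, j).
Proof.
  intros Hj; destruct j as [|j]; [lia|]; unfold rhs_nonlin, rhs_a.
  simpl fst; simpl snd; cbv iota; simpl zero_ext; ring.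
Qed.

Lemma rhs_b_split (lam theta mu d_i : R) (x : bool * nat -> R) (j : nat) :
  (1 <= j)%nat ->
  rhs_b lam theta mu d_i (fun k => x (true, k)) (fun k => x (false, k)) j
    = - (mu * (lam ^ j) ^ 2) * x (false, j) + rhs_nonlin lam theta d_i x (false, j).
Proof.
  intros Hj; destruct j as [|j]; [lia|]; unfold rhs_nonlin, rhs_b.
  simpl fst; simpl snd; cbv iota; simpl zero_ext; ring.
Qed.

Lemma clipped_id (lam M : R) (x : bool * nat -> R) :
  (forall i, Rabs (x i) <= M / lam ^ snd i) -> clipped lam M x = x.
Proof.
  intros H; apply FunctionalExtensionality.functional_extensionality; intros i.
  apply clip_id, H.
Qed.

(** Where the bound of level [M] holds, clipping is the identity and [U] solves the original system;
    the derivatives are then continuous because the right-hand sides involve finitely many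
    continuous components. The set [D] is arbitrary so as to cover both bounded intervals and the
    half-line. *)
Lemma clipped_solution_strong (lam theta nu mu d_i M : R) (a0 b0 : nat -> R) U (D : R -> Prop) :
  1 < lam -> 0 <= theta < 2 -> 0 < nu -> 0 < mu -> 0 <= d_i -> 0 <= M ->
  in_Hs lam 1 a0 -> in_Hs lam 1 b0 ->
  clipped_solution lam theta nu mu d_i M (pair_family a0 b0) U ->
  (forall t, D t -> 0 <= t) ->
  (forall t i, D t -> Rabs (U i t) <= M / lam ^ snd i) ->
  let a t j := U (true, j) t in
  let b t j := U (false, j) t in
  solution_on lam theta nu mu d_i D a b /\
  Hs_bounded_on lam 1 D a /\ Hs_bounded_on lam 1 D b.
Proof.
  intros Hl Hth Hnu Hmu Hd HM Ha0 Hb0 Sol HD HU a b.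
  destruct (clipped_solution_decay _ _ _ _ _ _ _ _ Hl (proj1 Hth) Hnu Hmu Hd HM Sol)
    as [K [HK Dec]].
  assert (Hrho : 0 <= Rpower lam (theta - 2) < 1).
  { split; [left; apply exp_pos|].
    rewrite <- (Rpower_O lam) by lra; apply Rpower_lt; lra. }
  assert (Ba : Hs_bounded_on lam 1 D a).
  { apply (H1_bounded_of_majorant lam (Rpower lam (theta - 2)) K a0); auto.
    intros t j Dt; apply (Dec (true, j)); auto. }
  assert (Bb : Hs_bounded_on lam 1 D b).
  { apply (H1_bounded_of_majorant lam (Rpower lam (theta - 2)) K b0); auto.
    intros t j Dt; apply (Dec (false, j)); auto. }
  split; [|now split].
  destruct Sol as [U0 dU].
  assert (CU : forall k t, 0 <= t -> continuous (U k) t).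
  { intros k t Ht; apply (ex_derive_continuous (U k)); eexists; now apply dU. }
  assert (dU' : forall i t, D t -> is_derive (U i) t
    (- damping lam nu mu i * U i t + rhs_nonlin lam theta d_i (fun k => U k t) i)).
  { intros i t Dt; specialize (dU i t (HD t Dt)).
    rewrite clipped_id in dU; auto. }
  assert (CF : forall i t, D t -> continuous (fun s =>
    - damping lam nu mu i * U i s + rhs_nonlin lam theta d_i (fun k => U k s) i) t).
  { intros i t Dt.
    apply (continuous_plus (V := R_NormedModule)).
    - apply (continuous_mult (K := R_AbsRing)); [apply continuous_const | apply CU; auto].
    - apply continuous_rhs_nonlin; intros k; apply CU; auto. }
  assert (Ea : forall j s, (1 <= j)%nat -> rhs_a lam theta nu (a s) (b s) j
    = - damping lam nu mu (true, j) * U (true, j) s + rhs_nonlin lam theta d_i (fun k => U k s) (true, j)).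
  { intros j s Hj; exact (rhs_a_split lam theta nu d_i (fun k => U k s) j Hj). }
  assert (Eb : forall j s, (1 <= j)%nat -> rhs_b lam theta mu d_i (a s) (b s) j
    = - damping lam nu mu (false, j) * U (false, j) s + rhs_nonlin lam theta d_i (fun k => U k s) (false, j)).
  { intros j s Hj; exact (rhs_b_split lam theta mu d_i (fun k => U k s) j Hj). }
  assert (Da : forall j t, (1 <= j)%nat -> D t ->
    D_in (fun t => a t j) (fun t => rhs_a lam theta nu (a t) (b t) j) D t).
  { intros j t Hj Dt; apply D_in_of_is_derive; rewrite Ea by assumption; now apply dU'. }
  assert (Db : forall j t, (1 <= j)%nat -> D t ->
    D_in (fun t => b t j) (fun t => rhs_b lam theta mu d_i (a t) (b t) j) D t).
  { intros j t Hj Dt; apply D_in_of_is_derive; rewrite Eb by assumption; now apply dU'. }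
  split.
  - intros t Dt; destruct Ba as [Ma Ba]; destruct Bb as [Mb Bb].
    split; apply (in_l2_of_H1 lam); auto; [now apply Ba | now apply Bb].
  - intros j Hj; repeat split; auto.
    + exists (fun t => rhs_a lam theta nu (a t) (b t) j); split; auto.
      intros t Dt; apply continue_in_of_continuous.
      eapply continuous_ext; [intros s; symmetry; now apply Ea | now apply CF].
    + exists (fun t => rhs_b lam theta mu d_i (a t) (b t) j); split; auto.
      intros t Dt; apply continue_in_of_continuous.
      eapply continuous_ext; [intros s; symmetry; now apply Eb | now apply CF].
Qed.

Lemma Hs_term_nonneg (lam : R) (u : nat -> R) (n : nat) : 1 < lam -> 0 <= Hs_term lam 1 u n.
Proof. intros; rewrite Hs_term_1 by assumption; apply pow2_ge_0. Qed.

Lemma H1_coef_bound (lam : R) (u : nat -> R) (j : nat) :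
  1 < lam -> in_Hs lam 1 u ->
  Rabs (zero_ext u j) <= sqrt (Series (fun k => Hs_term lam 1 u (S k))) / lam ^ j.
Proof.
  intros Hl Hu.
  assert (Hp : 0 < lam ^ j) by (apply pow_lt; lra).
  destruct j as [|j].
  - simpl; rewrite Rabs_R0; unfold Rdiv; rewrite Rinv_1, Rmult_1_r; apply sqrt_pos.
  - apply Rmult_le_reg_l with (lam ^ S j); auto.
    replace (lam ^ S j * (_ / _)) with (sqrt (Series (fun k => Hs_term lam 1 u (S k)))) by (field; lra).
    simpl zero_ext.
    rewrite <- (Rabs_pos_eq (lam ^ S j)), <- Rabs_mult, <- sqrt_Rsqr_abs by lra.
    apply sqrt_le_1_alt.
    rewrite Rsqr_pow2, <- Hs_term_1 by assumption.
    eapply Rle_trans; [|apply (sum_n_le_Series _ j); auto using Hs_term_nonneg].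
    apply (term_le_sum_n (fun k => Hs_term lam 1 u (S k))); auto using Hs_term_nonneg.
Qed.

(** * Energy and enstrophy estimates for theta = 1 *)

Lemma lyapunov_gronwall (E Y E' Y' : R -> R) (m C eps T : R) :
  0 < m -> 0 <= C -> 0 <= T ->
  (forall t, 0 <= t <= T -> is_derive E t (E' t)) ->
  (forall t, 0 <= t <= T -> is_derive Y t (Y' t)) ->
  (forall t, 0 <= t <= T -> 0 <= E t) ->
  (forall t, 0 <= t <= T -> 0 <= Y t) ->
  (forall t, 0 <= t <= T -> E' t <= - m * Y t) ->
  (forall t, 0 <= t <= T -> Y' t <= C * Y t * (Y t + eps)) ->
  Y T <= Y 0 * exp (C / m * E 0 + C * eps * T).
Proof.
  intros Hm HC HT dE dY PE PY HE HY.
  set (k := C / m).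
  assert (Hk : 0 <= k) by now apply Rdiv_le_0_compat.
  assert (km : k * m = C) by (unfold k; field; lra).
  assert (V : Y T * exp (k * E T - C * eps * T) <= Y 0 * exp (k * E 0 - C * eps * 0)).
  { apply (nonincreasing_of_derive (fun t => Y t * exp (k * E t - C * eps * t))
      (fun t => exp (k * E t - C * eps * t) * (Y' t + Y t * (k * E' t - C * eps)))); auto.
    - intros x Hx; pose proof (dE x Hx) as e; pose proof (dY x Hx) as y.
      auto_derive.
      + repeat split; [now exists (Y' x) | now exists (E' x)].
      + rewrite (is_derive_unique (fun x : R => Y x) x _ y).
        rewrite (is_derive_unique (fun x : R => E x) x _ e).
        unfold Rminus; ring.
    - intros x Hx; specialize (PY x Hx); specialize (HE x Hx); specialize (HY x Hx).
      pose proof (exp_pos (k * E x - C * eps * x)) as P.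
      assert (k * E' x <= - C * Y x).
      { replace (- C * Y x) with (k * (- m * Y x)) by (rewrite <- km; ring).
        now apply Rmult_le_compat_l. }
      assert (Y x * (k * E' x - C * eps) <= Y x * (- C * Y x - C * eps)).
      { apply Rmult_le_compat_l; lra. }
      assert (Y' x + Y x * (k * E' x - C * eps) <= 0); [|nra].
      eapply Rle_trans; [apply Rplus_le_compat; eassumption|]; right; ring. }
  rewrite Rmult_0_r, Rminus_0_r in V.
  rewrite exp_plus.
  assert (Q : exp (k * E T - C * eps * T) * exp (C * eps * T) = exp (k * E T)).
  { rewrite <- exp_plus; f_equal; ring. }
  assert (1 <= exp (k * E T)).
  { pose proof (exp_ineq1_le (k * E T)).
    assert (0 <= k * E T) by (apply Rmult_le_pos; auto; apply PE; lra); lra. }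
  apply Rle_trans with (Y T * exp (k * E T)).
  { assert (0 <= Y T) by (apply PY; lra); nra. }
  rewrite <- Q.
  pose proof (exp_pos (C * eps * T)); nra.
Qed.

Section Shell.

Variables (lam nu mu d_i : R).
Hypothesis Hl : 1 < lam.
Hypothesis Hnu : 0 < nu.
Hypothesis Hmu : 0 < mu.
Hypothesis Hd : 0 <= d_i.
Variables (x y : nat -> R).
Hypothesis Hx0 : x 0%nat = 0.
Hypothesis Hy0 : y 0%nat = 0.

Let m := Rmin nu mu.

(* The quadratic parts of the system for [theta = 1], i.e. [delta = 3]. *)
Definition quad_a (j : nat) : R :=
  - lam ^ j * x j * x (S j) + lam ^ pred j * x (pred j) ^ 2
  + lam ^ j * y j * y (S j) - lam ^ pred j * y (pred j) ^ 2.

Definition quad_b (j : nat) : R :=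
  - lam ^ j * x j * y (S j) + lam ^ j * y j * x (S j)
  - d_i * ((lam ^ j) ^ 2 * y j * y (S j) - (lam ^ pred j) ^ 2 * y (pred j) ^ 2).

Definition enstrophy_shell (j : nat) : R := (lam ^ j) ^ 2 * (x j ^ 2 + y j ^ 2).

(* The transfer terms telescope: only the flux through shell [N] survives. *)
Lemma energy_flux (N : nat) :
  sum_n (fun j => x j * quad_a j + y j * quad_b j) N
  = - (lam ^ N * x N ^ 2 * x (S N) - lam ^ N * y N ^ 2 * x (S N)
       + d_i * (lam ^ N) ^ 2 * y N ^ 2 * y (S N)).
Proof.
  induction N as [|N IH].
  - rewrite sum_O, Hx0, Hy0; match goal with |- ?u = ?v => change (@eq R u v) end; ring.
  - rewrite sum_Sn, IH; change plus with Rplus; unfold quad_a, quad_b.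
    simpl pred; match goal with |- ?u = ?v => change (@eq R u v) end; ring.
Qed.

Lemma enstrophy_shell_nonneg (j : nat) : 0 <= enstrophy_shell j.
Proof.
  apply Rmult_le_pos; [apply pow2_ge_0|].
  pose proof (pow2_ge_0 (x j)); pose proof (pow2_ge_0 (y j)); lra.
Qed.

(** The flux coefficients are at most of order [lambda_N^2], the weight of the enstrophy, so the
    flux is bounded by [(2 + d_i) * r] times the last shell. The viscous terms give [- 2 m] times
    the enstrophy and twice the flux uses up half of it. *)
Lemma energy_dissipation (N : nat) (r : R) :
  Rabs (x (S N)) <= r -> Rabs (y (S N)) <= r -> (2 + d_i) * r <= m / 2 ->
  sum_n (fun j => 2 * (x j * (- nu * (lam ^ j) ^ 2 * x j + quad_a j)
                     + y j * (- mu * (lam ^ j) ^ 2 * y j + quad_b j))) N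
  <= - m * sum_n enstrophy_shell N.
Proof.
  intros Hx Hy Hr.
  assert (mn : m <= nu) by apply Rmin_l.
  assert (mm : m <= mu) by apply Rmin_r.
  apply Rle_trans with
    (sum_n (fun j => plus (-2 * m * enstrophy_shell j) (2 * (x j * quad_a j + y j * quad_b j))) N).
  { apply sum_n_monotone; intros j; change plus with Rplus; unfold enstrophy_shell.
    pose proof (pow2_ge_0 (lam ^ j * x j)); pose proof (pow2_ge_0 (lam ^ j * y j)); nra. }
  rewrite sum_n_plus.
  rewrite (sum_n_mult_l (K := R_Ring) (-2 * m) enstrophy_shell).
  rewrite (sum_n_mult_l (K := R_Ring) 2 (fun j => x j * quad_a j + y j * quad_b j)).
  rewrite energy_flux; change plus with Rplus; change mult with Rmult.
  assert (Sle : enstrophy_shell N <= sum_n enstrophy_shell N).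
  { apply term_le_sum_n; auto using enstrophy_shell_nonneg. }
  set (Y := sum_n enstrophy_shell N : R) in *.
  match goal with |- -2 * m * ?s + _ <= _ => change s with Y end.
  assert (Hp : 1 <= lam ^ N) by now apply pow_ge_1.
  assert (Hr0 : 0 <= r) by (eapply Rle_trans; [apply Rabs_pos | exact Hx]).
  assert (Fl : - (lam ^ N * x N ^ 2 * x (S N) - lam ^ N * y N ^ 2 * x (S N)
       + d_i * (lam ^ N) ^ 2 * y N ^ 2 * y (S N)) <= (2 + d_i) * r * enstrophy_shell N).
  { unfold enstrophy_shell; set (l := lam ^ N) in *.
    pose proof (pow2_ge_0 (x N)); pose proof (pow2_ge_0 (y N)).
    apply Rabs_le_between in Hx, Hy.
    set (X2 := x N ^ 2) in *; set (Y2 := y N ^ 2) in *.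
    assert (LL : l <= l ^ 2) by nra.
    assert (0 <= l * X2 <= l ^ 2 * X2) by (split; nra).
    assert (0 <= l * Y2 <= l ^ 2 * Y2) by (split; nra).
    assert (- (l * X2 * x (S N)) <= l ^ 2 * X2 * r) by nra.
    assert (l * Y2 * x (S N) <= l ^ 2 * Y2 * r) by nra.
    assert (- (l ^ 2 * Y2 * y (S N)) <= l ^ 2 * Y2 * r) by nra.
    assert (d_i * (- (l ^ 2 * Y2 * y (S N))) <= d_i * (l ^ 2 * Y2 * r)) by (now apply Rmult_le_compat_l).
    assert (0 <= l ^ 2 * X2 * r) by (apply Rmult_le_pos; lra).
    assert (0 <= l ^ 2 * Y2 * r) by (apply Rmult_le_pos; lra).
    assert (0 <= d_i * (l ^ 2 * X2 * r)) by (apply Rmult_le_pos; lra).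
    lra. }
  assert ((2 + d_i) * r * enstrophy_shell N <= m / 2 * Y).
  { pose proof (enstrophy_shell_nonneg N).
    apply Rmult_le_compat; auto; apply Rmult_le_pos; lra. }
  lra.
Qed.

(** The square of a sum of four terms is at most four times the sum of squares. The Hall coefficient
    squared, [lambda_j^4], is still absorbed by the product [lambda_j^2 * lambda_(j+1)^2] of the
    weights of two neighbouring shells. *)
Lemma quad_square_bound (j : nat) :
  quad_a j ^ 2 + quad_b j ^ 2
  <= 4 * (1 + d_i ^ 2) * (enstrophy_shell j * enstrophy_shell (S j) + enstrophy_shell (pred j) ^ 2).
Proof.
  assert (Sq : forall p q r s, (p + q + r - s) ^ 2 <= 4 * (p ^ 2 + q ^ 2 + r ^ 2 + s ^ 2)).
  { intros p q r s.
    pose proof (pow2_ge_0 (p - q)); pose proof (pow2_ge_0 (p - r)); pose proof (pow2_ge_0 (p + s)).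
    pose proof (pow2_ge_0 (q - r)); pose proof (pow2_ge_0 (q + s)); pose proof (pow2_ge_0 (r + s)).
    lra. }
  set (l := lam ^ j); set (lp := lam ^ pred j).
  assert (Hlp : 1 <= lp) by now apply pow_ge_1.
  assert (Hlj : 1 <= l) by now apply pow_ge_1.
  assert (Ls : l <= lam ^ S j) by (change (lam ^ S j) with (lam * l); nra).
  set (ls := lam ^ S j) in *.
  assert (S1 : 1 <= lp ^ 2) by (apply pow_R1_Rle; lra).
  assert (S2 : l ^ 2 <= ls ^ 2) by (apply pow_incr; lra).
  assert (S3 : 1 <= l ^ 2) by (apply pow_R1_Rle; lra).
  assert (Q1 : quad_a j ^ 2 <= 4 * ((l * x j * x (S j)) ^ 2 + (lp * x (pred j) ^ 2) ^ 2
    + (l * y j * y (S j)) ^ 2 + (lp * y (pred j) ^ 2) ^ 2)).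
  { replace ((l * x j * x (S j)) ^ 2) with ((- l * x j * x (S j)) ^ 2) by ring; apply Sq. }
  assert (Q2 : quad_b j ^ 2 <= 4 * ((l * x j * y (S j)) ^ 2 + (l * y j * x (S j)) ^ 2
    + (d_i * (lp ^ 2 * y (pred j) ^ 2)) ^ 2 + (d_i * (l ^ 2 * y j * y (S j))) ^ 2)).
  { replace ((l * x j * y (S j)) ^ 2) with ((- l * x j * y (S j)) ^ 2) by ring.
    eapply Rle_trans; [|apply Sq]; right; unfold quad_b; fold l lp; ring. }
  unfold enstrophy_shell; fold l lp ls.
  set (xj := x j ^ 2); set (yj := y j ^ 2); set (xs := x (S j) ^ 2); set (ys := y (S j) ^ 2).
  set (xp := x (pred j) ^ 2) in *; set (yp := y (pred j) ^ 2) in *.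
  assert (0 <= xj) by apply pow2_ge_0; assert (0 <= yj) by apply pow2_ge_0.
  assert (0 <= xs) by apply pow2_ge_0; assert (0 <= ys) by apply pow2_ge_0.
  assert (0 <= xp) by apply pow2_ge_0; assert (0 <= yp) by apply pow2_ge_0.
  assert (mono : forall u v, 0 <= u -> 0 <= v -> l ^ 2 * u * v <= (l ^ 2 * u) * (ls ^ 2 * v)).
  { intros u v Hu Hv; apply Rmult_le_compat_l; [apply Rmult_le_pos; [apply pow2_ge_0 | auto]|].
    nra. }
  assert (mono2 : forall u v, 0 <= u -> 0 <= v -> (l ^ 2) ^ 2 * u * v <= (l ^ 2 * u) * (ls ^ 2 * v)).
  { intros u v Hu Hv; replace ((l ^ 2) ^ 2 * u * v) with ((l ^ 2 * u) * (l ^ 2 * v)) by ring.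
    apply Rmult_le_compat_l; [apply Rmult_le_pos; [apply pow2_ge_0 | auto]|].
    now apply Rmult_le_compat_r. }
  assert (mono3 : forall u, 0 <= u -> lp ^ 2 * u ^ 2 <= (lp ^ 2 * u) ^ 2).
  { intros u Hu; replace ((lp ^ 2 * u) ^ 2) with (lp ^ 2 * (lp ^ 2 * u ^ 2)) by ring.
    apply Rmult_le_compat_l; [apply pow2_ge_0|]; pose proof (pow2_ge_0 u); nra. }
  replace ((l * x j * x (S j)) ^ 2) with (l ^ 2 * xj * xs) in Q1 by (unfold xj, xs; ring).
  replace ((l * y j * y (S j)) ^ 2) with (l ^ 2 * yj * ys) in Q1 by (unfold yj, ys; ring).
  replace ((lp * xp) ^ 2) with (lp ^ 2 * xp ^ 2) in Q1 by ring.
  replace ((lp * yp) ^ 2) with (lp ^ 2 * yp ^ 2) in Q1 by ring.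
  replace ((l * x j * y (S j)) ^ 2) with (l ^ 2 * xj * ys) in Q2 by (unfold xj, ys; ring).
  replace ((l * y j * x (S j)) ^ 2) with (l ^ 2 * yj * xs) in Q2 by (unfold yj, xs; ring).
  replace ((d_i * (l ^ 2 * y j * y (S j))) ^ 2) with (d_i ^ 2 * ((l ^ 2) ^ 2 * yj * ys)) in Q2
    by (unfold yj, ys; ring).
  replace ((d_i * (lp ^ 2 * yp)) ^ 2) with (d_i ^ 2 * (lp ^ 2 * yp) ^ 2) in Q2 by ring.
  pose proof (mono xj xs ltac:(auto) ltac:(auto)) as M1.
  pose proof (mono yj ys ltac:(auto) ltac:(auto)) as M2.
  pose proof (mono xj ys ltac:(auto) ltac:(auto)) as M3.
  pose proof (mono yj xs ltac:(auto) ltac:(auto)) as M4.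
  pose proof (mono2 yj ys ltac:(auto) ltac:(auto)) as M5.
  pose proof (mono3 xp ltac:(auto)) as M6.
  pose proof (mono3 yp ltac:(auto)) as M7.
  apply (Rmult_le_compat_l (d_i ^ 2)) in M5; [|apply pow2_ge_0].
  replace (l ^ 2 * (xj + yj) * (ls ^ 2 * (xs + ys)))
    with (l ^ 2 * xj * (ls ^ 2 * xs) + l ^ 2 * xj * (ls ^ 2 * ys)
      + l ^ 2 * yj * (ls ^ 2 * xs) + l ^ 2 * yj * (ls ^ 2 * ys)) by ring.
  replace ((lp ^ 2 * (xp + yp)) ^ 2)
    with ((lp ^ 2 * xp) ^ 2 + 2 * (lp ^ 2 * xp) * (lp ^ 2 * yp) + (lp ^ 2 * yp) ^ 2) by ring.
  assert (Hl2 : 0 <= l ^ 2) by apply pow2_ge_0.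
  assert (Hls2 : 0 <= ls ^ 2) by apply pow2_ge_0.
  assert (Hlp2 : 0 <= lp ^ 2) by apply pow2_ge_0.
  assert (pos : forall p u q v, 0 <= p -> 0 <= u -> 0 <= q -> 0 <= v -> 0 <= p * u * (q * v)).
  { intros; apply Rmult_le_pos; now apply Rmult_le_pos. }
  assert (P1 : 0 <= l ^ 2 * xj * (ls ^ 2 * xs)) by now apply pos.
  assert (P2 : 0 <= l ^ 2 * xj * (ls ^ 2 * ys)) by now apply pos.
  assert (P3 : 0 <= l ^ 2 * yj * (ls ^ 2 * xs)) by now apply pos.
  assert (P4 : 0 <= (lp ^ 2 * xp) * (lp ^ 2 * yp)) by now apply pos.
  assert (P5 : 0 <= (lp ^ 2 * xp) ^ 2) by apply pow2_ge_0.
  assert (D2 : 0 <= d_i ^ 2) by apply pow2_ge_0.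
  pose proof (Rmult_le_pos _ _ D2 P1); pose proof (Rmult_le_pos _ _ D2 P2).
  pose proof (Rmult_le_pos _ _ D2 P3); pose proof (Rmult_le_pos _ _ D2 P4).
  pose proof (Rmult_le_pos _ _ D2 P5).
  lra.
Qed.

(* The term [- enstrophy_shell N ^ 2] is what makes the induction go through. *)
Lemma neighbour_sum (N : nat) :
  sum_n (fun j => enstrophy_shell j * enstrophy_shell (S j) + enstrophy_shell (pred j) ^ 2) N
  <= 2 * sum_n enstrophy_shell N ^ 2 - enstrophy_shell N ^ 2
     + enstrophy_shell N * enstrophy_shell (S N).
Proof.
  induction N as [|N IH].
  - rewrite !sum_O; simpl pred; lra.
  - rewrite !sum_Sn; change plus with Rplus; simpl pred.
    pose proof (term_le_sum_n enstrophy_shell N N enstrophy_shell_nonneg (Nat.le_refl N)).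
    pose proof (enstrophy_shell_nonneg N); pose proof (enstrophy_shell_nonneg (S N)).
    nra.
Qed.

Lemma enstrophy_growth (N : nat) (eps : R) :
  enstrophy_shell (S N) <= eps ->
  sum_n (fun j => 2 * (lam ^ j) ^ 2 * (x j * (- nu * (lam ^ j) ^ 2 * x j + quad_a j)
                     + y j * (- mu * (lam ^ j) ^ 2 * y j + quad_b j))) N
  <= 4 * (1 + d_i ^ 2) / m * sum_n enstrophy_shell N * (sum_n enstrophy_shell N + eps).
Proof.
  intros Heps.
  assert (Hm : 0 < m) by now apply Rmin_pos.
  assert (mn : m <= nu) by apply Rmin_l.
  assert (mm : m <= mu) by apply Rmin_r.
  (* Completing the square: the weight [p] is also the damping factor, so the viscous term absorbs
     the [p * z] part of the product and leaves only [q ^ 2]. *)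
  assert (half : forall c p z q, m <= c -> 2 * p * (z * (- c * p * z + q)) <= / (2 * m) * q ^ 2).
  { intros c p z q Hc.
    apply Rle_trans with (2 * p * (z * (- m * p * z + q))).
    - pose proof (pow2_ge_0 (p * z)); nra.
    - apply Rminus_le.
      replace (_ - _) with (- (/ (2 * m) * (q - 2 * m * p * z) ^ 2)) by (field; lra).
      assert (0 <= / (2 * m) * (q - 2 * m * p * z) ^ 2); [|lra].
      apply Rmult_le_pos; [left; apply Rinv_0_lt_compat; lra | apply pow2_ge_0]. }
  set (C := / (2 * m) * (4 * (1 + d_i ^ 2))).
  assert (HC : 0 <= C).
  { unfold C; apply Rmult_le_pos; [left; apply Rinv_0_lt_compat; lra|].
    pose proof (pow2_ge_0 d_i); lra. }
  apply Rle_trans with (sum_n (fun j => C * (enstrophy_shell j * enstrophy_shell (S j)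
    + enstrophy_shell (pred j) ^ 2)) N).
  { apply sum_n_monotone; intros j.
    apply Rle_trans with (/ (2 * m) * (quad_a j ^ 2 + quad_b j ^ 2)).
    - pose proof (half nu ((lam ^ j) ^ 2) (x j) (quad_a j) mn).
      pose proof (half mu ((lam ^ j) ^ 2) (y j) (quad_b j) mm); lra.
    - unfold C; rewrite Rmult_assoc.
      apply Rmult_le_compat_l; [left; apply Rinv_0_lt_compat; lra | apply quad_square_bound]. }
  rewrite (sum_n_mult_l (K := R_Ring) C); change mult with Rmult.
  replace (4 * (1 + d_i ^ 2) / m) with (C * 2) by (unfold C; field; lra).
  rewrite !Rmult_assoc; apply Rmult_le_compat_l; auto.
  eapply Rle_trans; [apply neighbour_sum|].
  pose proof (term_le_sum_n enstrophy_shell N N enstrophy_shell_nonneg (Nat.le_refl N)).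
  pose proof (enstrophy_shell_nonneg N); pose proof (enstrophy_shell_nonneg (S N)).
  assert (enstrophy_shell N * enstrophy_shell (S N) <= sum_n enstrophy_shell N * eps).
  { apply Rmult_le_compat; auto. }
  pose proof (pow2_ge_0 (enstrophy_shell N)).
  assert (0 <= sum_n enstrophy_shell N * eps) by (apply Rmult_le_pos; lra).
  lra.
Qed.

End Shell.

(** * Global bound *)

Definition H1_energy (lam : R) (a b : nat -> R) : R :=
  Series (fun k => Hs_term lam 1 a (S k) + Hs_term lam 1 b (S k)).

Lemma ex_series_H1_energy (lam : R) (a b : nat -> R) :
  in_Hs lam 1 a -> in_Hs lam 1 b ->
  ex_series (fun k => Hs_term lam 1 a (S k) + Hs_term lam 1 b (S k)).
Proof. apply (ex_series_plus (V := R_NormedModule)). Qed.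

Lemma enstrophy_shell_succ (lam : R) (a b : nat -> R) (j : nat) :
  1 < lam ->
  enstrophy_shell lam (zero_ext a) (zero_ext b) (S j)
    = Hs_term lam 1 a (S j) + Hs_term lam 1 b (S j).
Proof. intros Hl; rewrite !Hs_term_1 by assumption; unfold enstrophy_shell; simpl zero_ext; ring. Qed.

Lemma enstrophy_sum_le (lam : R) (a b : nat -> R) (N : nat) :
  1 < lam -> in_Hs lam 1 a -> in_Hs lam 1 b ->
  sum_n (enstrophy_shell lam (zero_ext a) (zero_ext b)) N <= H1_energy lam a b.
Proof.
  intros Hl Ha Hb.
  set (f := enstrophy_shell lam (zero_ext a) (zero_ext b)).
  (* Shell 0 vanishes, so shells up to [S N] correspond to the terms of the series up to [N]. *)
  assert (E : sum_n f (S N) = sum_n (fun k => Hs_term lam 1 a (S k) + Hs_term lam 1 b (S k)) N).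
  { induction N as [|N IH].
    - rewrite sum_Sn, !sum_O; change plus with Rplus; unfold f.
      rewrite enstrophy_shell_succ by assumption.
      unfold enstrophy_shell; simpl zero_ext.
      match goal with |- ?u = ?v => change (@eq R u v) end; ring.
    - rewrite sum_Sn, IH, sum_Sn; unfold f; now rewrite enstrophy_shell_succ. }
  apply Rle_trans with (sum_n f (S N)).
  - rewrite sum_Sn; change plus with Rplus.
    pose proof (enstrophy_shell_nonneg lam (zero_ext a) (zero_ext b) (S N)); unfold f; lra.
  - rewrite E; apply sum_n_le_Series; [|now apply ex_series_H1_energy].
    intros k; apply Rplus_le_le_0_compat; now apply Hs_term_nonneg.
Qed.

(** At index 0 every quadratic term contains a factor [zero_ext _ 0], so the equation is pure
    damping from the value 0. *)
Lemma clipped_solution_component_0 (lam theta nu mu d_i M : R) (a0 b0 : nat -> R) U :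
  1 < lam -> 0 < nu -> 0 < mu ->
  clipped_solution lam theta nu mu d_i M (pair_family a0 b0) U ->
  forall s t, 0 <= t -> U (s, 0%nat) t = 0.
Proof.
  intros Hl Hnu Hmu [U0 dU] s t Ht.
  assert (B : Rabs (U (s, 0%nat) t) <= 0).
  { apply (damped_comparison (U (s, 0%nat)) (fun t => - damping lam nu mu (s, 0%nat) * U (s, 0%nat) t)
      (fun _ => 0) (fun _ => 0) (damping lam nu mu (s, 0%nat)) 0 t); auto.
    - intros x Hx; pose proof (dU (s, 0%nat) x (proj1 Hx)) as e.
      replace (- damping lam nu mu (s, 0%nat) * U (s, 0%nat) x)
        with (- damping lam nu mu (s, 0%nat) * U (s, 0%nat) x
          + rhs_nonlin lam theta d_i (clipped lam M (fun k => U k x)) (s, 0%nat)); auto.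
      destruct s; unfold rhs_nonlin, rhs_a, rhs_b; simpl; ring.
    - intros x _; apply (is_derive_const (V := R_NormedModule)).
    - intros x _; match goal with |- Rabs ?e <= _ => replace e with 0 by ring end.
      rewrite Rabs_R0; lra.
    - rewrite U0; unfold pair_family; simpl; rewrite Rabs_R0; lra. }
  destruct (Req_dec (U (s, 0%nat) t) 0) as [Z|Z]; auto.
  apply Rabs_pos_lt in Z; lra.
Qed.

(** Square root of the bound in [lyapunov_gronwall], with energy and enstrophy at time 0 both
    replaced by [H]. The [+ 1] stands for [C * eps * T], made at most 1 by the choice of the number
    of shells. *)
Definition a_priori_radius (lam nu mu d_i : R) (a0 b0 : nat -> R) : R :=
  let m := Rmin nu mu in
  let H := H1_energy lam a0 b0 in
  sqrt (H * exp (4 * (1 + d_i ^ 2) / m / m * H + 1)).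

Lemma is_derive_square_sum (f g : R -> R) (f' g' c t : R) :
  is_derive f t f' -> is_derive g t g' ->
  is_derive (fun s => c * (f s ^ 2 + g s ^ 2)) t (2 * c * (f t * f' + g t * g')).
Proof.
  intros df dg; auto_derive.
  - repeat split; [now exists f' | now exists g'].
  - rewrite (is_derive_unique (fun x : R => f x) t _ df).
    rewrite (is_derive_unique (fun x : R => g x) t _ dg); ring.
Qed.

(** The cut-off [N] is chosen after [T], [M] and the component, so neither [T] nor [M] enters the
    radius. The estimates are run on the first [N] shells, and the component is then read off as one
    term of the enstrophy sum. *)
Lemma clipped_solution_a_priori (lam nu mu d_i M T : R) (a0 b0 : nat -> R) U :
  1 < lam -> 0 < nu -> 0 < mu -> 0 <= d_i -> 0 <= M -> 0 <= T ->
  in_Hs lam 1 a0 -> in_Hs lam 1 b0 ->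
  clipped_solution lam 1 nu mu d_i M (pair_family a0 b0) U ->
  (forall t i, 0 <= t <= T -> Rabs (U i t) <= M / lam ^ snd i) ->
  forall i, Rabs (U i T) <= a_priori_radius lam nu mu d_i a0 b0 / lam ^ snd i.
Proof.
  intros Hl Hnu Hmu Hd HM HT Ha Hb Sol HU.
  assert (Hm : 0 < Rmin nu mu) by now apply Rmin_pos.
  destruct (clipped_solution_decay lam 1 _ _ _ _ _ _ Hl ltac:(lra) Hnu Hmu Hd HM Sol) as [K [HK Dec]].
  set (rho := Rpower lam (1 - 2)) in Dec.
  assert (Hrho : 0 <= rho < 1).
  { split; [left; apply exp_pos|].
    unfold rho; apply Rlt_le_trans with (Rpower lam 0); [apply Rpower_lt; lra|].
    rewrite Rpower_O; lra. }
  intros [s [|j]].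
  (* Index 0 is treated apart, since [X] and [Z] below replace that component by 0. *)
  { rewrite (clipped_solution_component_0 lam 1 nu mu d_i M a0 b0); auto.
    rewrite Rabs_R0; apply Rdiv_le_0_compat; [apply sqrt_pos | apply pow_lt; lra]. }
  destruct Sol as [U0 dU].
  set (X := fun t => zero_ext (fun k => U (true, k) t)).
  set (Z := fun t => zero_ext (fun k => U (false, k) t)).
  assert (dX : forall k t, 0 <= t <= T -> is_derive (fun t => X t k) t
    (- nu * (lam ^ k) ^ 2 * X t k + quad_a lam (X t) (Z t) k)).
  { intros [|k] t Ht.
    - match goal with |- is_derive _ _ ?e => replace e with 0 end.
      + change (is_derive (fun _ : R => 0) t 0); apply (is_derive_const (V := R_NormedModule)).
      + unfold quad_a, X, Z; simpl; ring.
    - pose proof (dU (true, S k) t (proj1 Ht)) as e.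
      rewrite clipped_id in e by (intros; now apply HU).
      match goal with |- is_derive _ _ ?e' => match type of e with is_derive _ _ ?e1 =>
        replace e' with e1; auto end end.
      unfold damping, rhs_nonlin, rhs_a, quad_a; simpl fst; simpl snd; cbv iota.
      rewrite !Rpower_1 by (apply pow_lt; lra); unfold X, Z; simpl zero_ext; ring. }
  assert (dZ : forall k t, 0 <= t <= T -> is_derive (fun t => Z t k) t
    (- mu * (lam ^ k) ^ 2 * Z t k + quad_b lam d_i (X t) (Z t) k)).
  { intros [|k] t Ht.
    - match goal with |- is_derive _ _ ?e => replace e with 0 end.
      + change (is_derive (fun _ : R => 0) t 0); apply (is_derive_const (V := R_NormedModule)).
      + unfold quad_b, X, Z; simpl; ring.
    - pose proof (dU (false, S k) t (proj1 Ht)) as e.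
      rewrite clipped_id in e by (intros; now apply HU).
      match goal with |- is_derive _ _ ?e' => match type of e with is_derive _ _ ?e1 =>
        replace e' with e1; auto end end.
      unfold damping, rhs_nonlin, rhs_b, quad_b; simpl fst; simpl snd; cbv iota.
      rewrite !Rpower_succ, !Rpower_1 by (apply pow_lt; lra).
      unfold X, Z; simpl zero_ext; ring. }
  (* The number [e N] is the [eps] of the enstrophy estimate: it bounds shell [S N] at all times in
     [[0, T]] and tends to 0. *)
  set (e := fun k => H1_majorant lam rho K a0 k + H1_majorant lam rho K b0 k).
  assert (He : is_lim_seq e 0).
  { apply ex_series_lim_0.
    apply (ex_series_plus (V := R_NormedModule)); now apply ex_series_H1_majorant. }
  assert (Se : forall k t, 0 <= t <= T -> enstrophy_shell lam (X t) (Z t) (S k) <= e k).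
  { intros k t Ht; unfold X, Z; rewrite enstrophy_shell_succ by assumption.
    apply Rplus_le_compat; apply Hs_term_majorant; auto.
    - apply (Dec (true, S k)), Ht.
    - apply (Dec (false, S k)), Ht. }
  set (C := 4 * (1 + d_i ^ 2) / Rmin nu mu).
  assert (HC : 0 <= C).
  { apply Rdiv_le_0_compat; auto; pose proof (pow2_ge_0 d_i); lra. }
  assert (HCT : 0 <= C * T) by now apply Rmult_le_pos.
  assert (Hr : is_lim_seq (fun n => M * / lam ^ S n) 0).
  { replace (Finite 0) with (Rbar_mult M 0) by (simpl; f_equal; ring).
    apply is_lim_seq_scal_l.
    apply is_lim_seq_ext with (fun n => (/ lam) ^ S n); [intros n; apply pow_inv|].
    apply -> (is_lim_seq_incr_1 (fun n => (/ lam) ^ n)); apply is_lim_seq_geom.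
    rewrite Rabs_pos_eq by (left; apply Rinv_0_lt_compat; lra).
    rewrite <- Rinv_1; apply Rinv_lt_contravar; lra. }
  apply is_lim_seq_spec in He; apply is_lim_seq_spec in Hr.
  assert (p1 : 0 < / (C * T + 1)) by (apply Rinv_0_lt_compat; lra).
  assert (p2 : 0 < Rmin nu mu / (2 * (2 + d_i))) by (apply Rdiv_lt_0_compat; lra).
  destruct (He (mkposreal _ p1)) as [N1 HN1]; destruct (Hr (mkposreal _ p2)) as [N2 HN2].
  (* Three demands on [N]: the shell [S j] is counted, [C * e N * T <= 1], and the components of
     index [S N] are small enough for [energy_dissipation]. *)
  set (N := Nat.max (S j) (Nat.max N1 N2)).
  specialize (HN1 N ltac:(lia)); specialize (HN2 N ltac:(lia)); simpl in HN1, HN2.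
  rewrite Rminus_0_r in HN1, HN2; apply Rabs_def2 in HN1, HN2.
  assert (R1 : (2 + d_i) * (M / lam ^ S N) <= Rmin nu mu / 2).
  { apply Rle_trans with ((2 + d_i) * (Rmin nu mu / (2 * (2 + d_i)))).
    - apply Rmult_le_compat_l; [lra|]; left; apply HN2.
    - right; field; lra. }
  assert (R2 : C * e N * T <= 1).
  { replace 1 with ((C * T + 1) * / (C * T + 1)) by (field; lra).
    replace (C * e N * T) with (C * T * e N) by ring.
    apply Rle_trans with (C * T * / (C * T + 1)).
    - apply Rmult_le_compat_l; lra.
    - apply Rmult_le_compat_r; lra. }
  assert (Yp : forall t, 0 <= sum_n (enstrophy_shell lam (X t) (Z t)) N).
  { intros t; apply sum_n_nonneg, enstrophy_shell_nonneg. }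
  pose proof (lyapunov_gronwall
    (* The factor [1 *] lets [is_derive_square_sum] treat the energy and the enstrophy alike. *)
    (fun t => sum_n (fun k => 1 * (X t k ^ 2 + Z t k ^ 2)) N)
    (fun t => sum_n (enstrophy_shell lam (X t) (Z t)) N)
    (fun t => sum_n (fun k => 2 * (X t k * (- nu * (lam ^ k) ^ 2 * X t k + quad_a lam (X t) (Z t) k)
                     + Z t k * (- mu * (lam ^ k) ^ 2 * Z t k + quad_b lam d_i (X t) (Z t) k))) N)
    (fun t => sum_n (fun k => 2 * (lam ^ k) ^ 2 * (X t k * (- nu * (lam ^ k) ^ 2 * X t k + quad_a lam (X t) (Z t) k)
                     + Z t k * (- mu * (lam ^ k) ^ 2 * Z t k + quad_b lam d_i (X t) (Z t) k))) N)
    (Rmin nu mu) C (e N) T Hm HC HT) as G.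
  assert (HG : sum_n (enstrophy_shell lam (X T) (Z T)) N
    <= H1_energy lam a0 b0 * exp (C / Rmin nu mu * H1_energy lam a0 b0 + 1)).
  { eapply Rle_trans; [apply G|]; clear G.
    - intros t Ht; apply (is_derive_sum_n (fun k t => 1 * (X t k ^ 2 + Z t k ^ 2))); intros k _.
      rewrite <- (Rmult_1_r 2) at 1.
      apply is_derive_square_sum; [now apply dX | now apply dZ].
    - intros t Ht; apply (is_derive_sum_n (fun k t => (lam ^ k) ^ 2 * (X t k ^ 2 + Z t k ^ 2))); intros k _.
      apply is_derive_square_sum; [now apply dX | now apply dZ].
    - intros t _; apply sum_n_nonneg; intros k.
      pose proof (pow2_ge_0 (X t k)); pose proof (pow2_ge_0 (Z t k)); lra.
    - intros t _; apply Yp.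
    - intros t Ht.
      apply (energy_dissipation lam nu mu d_i Hl Hd (X t) (Z t) eq_refl eq_refl N (M / lam ^ S N)); auto.
      + apply (HU t (true, S N) Ht).
      + apply (HU t (false, S N) Ht).
    - intros t Ht; apply (enstrophy_growth lam nu mu d_i Hl Hnu Hmu (X t) (Z t) N (e N)).
      apply Se; auto.
    - assert (B : sum_n (enstrophy_shell lam (X 0) (Z 0)) N <= H1_energy lam a0 b0).
      { eapply Rle_trans; [|apply (enstrophy_sum_le lam a0 b0 N); auto].
        right; apply sum_n_ext; intros [|k]; unfold X, Z, enstrophy_shell; simpl zero_ext;
          rewrite ?U0; reflexivity. }
      (* The energy is below the enstrophy because every [lambda_j] is at least 1. *)
      assert (B' : sum_n (fun k => 1 * (X 0 k ^ 2 + Z 0 k ^ 2)) N <= H1_energy lam a0 b0).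
      { eapply Rle_trans; [|apply B]; apply sum_n_monotone; intros k; unfold enstrophy_shell.
        apply Rmult_le_compat_r.
        - pose proof (pow2_ge_0 (X 0 k)); pose proof (pow2_ge_0 (Z 0 k)); lra.
        - apply pow_R1_Rle; now apply pow_ge_1. }
      apply Rmult_le_compat; auto; [left; apply exp_pos|].
      apply exp_monotone.
      apply Rplus_le_compat; auto.
      apply Rmult_le_compat_l; auto; now apply Rdiv_le_0_compat. }
  assert (Hp : 0 < lam ^ S j) by (apply pow_lt; lra).
  change (snd (s, S j)) with (S j).
  apply Rmult_le_reg_l with (lam ^ S j); auto.
  replace (lam ^ S j * (_ / _)) with (a_priori_radius lam nu mu d_i a0 b0) by (field; lra).
  rewrite <- (Rabs_pos_eq (lam ^ S j)), <- Rabs_mult, <- sqrt_Rsqr_abs by lra.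
  apply sqrt_le_1_alt; rewrite Rsqr_pow2.
  eapply Rle_trans; [|apply HG].
  eapply Rle_trans; [|apply (term_le_sum_n (enstrophy_shell lam (X T) (Z T)) (S j) N);
    [apply enstrophy_shell_nonneg | lia]].
  unfold X, Z; rewrite enstrophy_shell_succ, !Hs_term_1 by assumption.
  pose proof (pow2_ge_0 (lam ^ S j * U (true, S j) T)).
  pose proof (pow2_ge_0 (lam ^ S j * U (false, S j) T)).
  destruct s; lra.
Qed.

Lemma pair_family_bound (lam : R) (a0 b0 : nat -> R) :
  1 < lam -> in_Hs lam 1 a0 -> in_Hs lam 1 b0 ->
  exists K, 0 <= K /\ forall i, Rabs (pair_family a0 b0 i) <= K / lam ^ snd i.
Proof.
  intros Hl Ha Hb.
  set (A := sqrt (Series (fun k => Hs_term lam 1 a0 (S k)))).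
  set (B := sqrt (Series (fun k => Hs_term lam 1 b0 (S k)))).
  assert (HA : 0 <= A) by apply sqrt_pos; assert (HB : 0 <= B) by apply sqrt_pos.
  exists (A + B); split; [lra|].
  intros [s j]; unfold pair_family; simpl fst; simpl snd.
  assert (Hi : 0 < / lam ^ j) by (apply Rinv_0_lt_compat, pow_lt; lra).
  destruct s; (eapply Rle_trans; [now apply (H1_coef_bound lam)|]);
    apply Rmult_le_compat_r; fold A B; lra.
Qed.

Theorem theorem6p1 (lam nu mu d_i delta theta : R)
  (hlam : 1 < lam) (hnu : 0 < nu) (hmu : 0 < mu) (hd_i : 0 < d_i)
  (htheta : theta = (5 - delta) / 2)
  (hdelta : 1 < delta <= 3)
  (a0 b0 : nat -> R) (ha0 : in_Hs lam 1 a0) (hb0 : in_Hs lam 1 b0) :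
  exists (T : R) (a b : R -> nat -> R),
    0 < T /\
    strong_solution_Icc lam theta nu mu d_i 0 T a b /\
    (forall j : nat, (1 <= j)%nat -> a 0 j = a0 j /\ b 0 j = b0 j) /\
    (delta = 3 -> strong_solution_Ici lam theta nu mu d_i 0 a b).
Proof.
  assert (hth : 0 <= theta < 2) by lra.
  destruct (pair_family_bound lam a0 b0 hlam ha0 hb0) as [K [HK Hx0]].
  (* [A] dominates the initial data and the a priori radius; truncating at level [A + 1] leaves room
     for the growth by 1 allowed during a time [eta]. *)
  set (A := Rmax K (a_priori_radius lam nu mu d_i a0 b0)).
  assert (HA : 0 <= A) by (eapply Rle_trans; [exact HK | apply Rmax_l]).
  assert (widen : forall r B u (i : bool * nat), r <= B -> u <= r / lam ^ snd i -> u <= B / lam ^ snd i).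
  { intros r B u i HrB H; eapply Rle_trans; [exact H|].
    apply Rmult_le_compat_r; auto; left; apply Rinv_0_lt_compat, pow_lt; lra. }
  destruct (clipped_global_solution lam theta nu mu d_i (A + 1) K (pair_family a0 b0))
    as [U Sol]; auto; try lra.
  destruct (clipped_solution_growth lam theta nu mu d_i (A + 1) (pair_family a0 b0) U)
    as [eta [Heta Gr]]; auto; try lra.
  assert (init : forall i, Rabs (U i 0) <= A / lam ^ snd i).
  { intros i; rewrite (proj1 Sol); apply (widen K); [apply Rmax_l | apply Hx0]. }
  assert (local : forall t i, Icc 0 eta t -> Rabs (U i t) <= (A + 1) / lam ^ snd i).
  { intros t i [h1 h2]; apply (Gr A 0 t); auto; lra. }
  assert (strong := fun D => clipped_solution_strong lam theta nu mu d_i (A + 1) a0 b0 U D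
    hlam hth hnu hmu (Rlt_le _ _ hd_i) ltac:(lra) ha0 hb0 Sol).
  exists eta, (fun t j => U (true, j) t), (fun t j => U (false, j) t).
  split; [exact Heta|]; split; [|split].
  - apply strong; auto; intros t [h _]; exact h.
  - intros [|j] Hj; [lia|]; now rewrite !(proj1 Sol).
  - intros delta3.
    replace theta with 1 in * by lra.
    (* Up to time [n * eta] truncation is inactive, so the a priori bound holds at that time and
       brings the level back to [A]. The next step thus starts from [A], and the growth by 1 does
       not accumulate. *)
    assert (inactive : forall n t i, 0 <= t <= INR n * eta -> Rabs (U i t) <= (A + 1) / lam ^ snd i).
    { induction n as [|n IH]; intros t i Ht.
      - simpl in Ht; replace t with 0 by lra; apply (widen A); auto; lra.
      - rewrite S_INR in Ht.
        assert (Hn : 0 <= INR n * eta) by (apply Rmult_le_pos; [apply pos_INR | lra]).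
        destruct (Rle_lt_dec t (INR n * eta)) as [h|h]; [apply IH; lra|].
        apply (Gr A (INR n * eta) t); auto; try lra.
        intros k; apply (widen (a_priori_radius lam nu mu d_i a0 b0)); [apply Rmax_r|].
        apply (clipped_solution_a_priori lam nu mu d_i (A + 1)); auto; lra. }
    assert (all : forall t i, 0 <= t -> Rabs (U i t) <= (A + 1) / lam ^ snd i).
    { intros t i Ht; destruct (INR_archimed eta t Heta) as [n Hn].
      apply (inactive n); lra. }
    split.
    + apply (strong (Ici 0)); auto.
    + intros T2 _; apply strong; [intros t [h _]; exact h | intros t i [h _]; auto].
Qed.
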